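(* Let $\alpha \in [0,1)$ and let $q_\alpha \in \mathcal{P}\big((1+\alpha)/2\big)$. Let $f \in \mathcal{B}$ be locally univalent (i.e. $f'(z)\neq 0$ for $z \in \mathbb{D}\setminus\{0\}$) and suppose that $$|S_f(z)| \leq 2\, q_\alpha(|z|) \quad \text{for all } z \in \mathbb{D}\setminus\{0\}.$$ Then $f \in \mathcal{BC}(\alpha)$. Moreover, the constant $(1+\alpha)/2$ is best possible: for every $\beta < (1+\alpha)/2$ there exist $q \in \mathcal{P}(\beta)$ and a locally univalent $f \in \mathcal{B}$ with $|S_f(z)| \le 2q(|z|)$ on $\mathbb{D}\setminus\{0\}$ such that $f \notin \mathcal{BC}(\alpha)$.
   Context: $\mathbb{D}=\{z\in\mathbb{C}:|z|<1\}$. $\mathcal{B}$ denotes the class of functions $f$ meromorphic in $\mathbb{D}$ of the form $f(z)=\frac1z+a_0+a_1z+a_2z^2+\cdots$ (analytic in $\mathbb{D}\setminus\{0\}$ with a simple pole of residue $1$ at $0$). For a locally univalent function $f$, the Schwarzian derivative is $S_f=\left(\frac{f''}{f'}\right)'-\frac12\left(\frac{f''}{f'}\right)^2$ (it extends analytically across $0$ for $f\in\mathcal B$). For $\alpha\in[0,1)$, $\mathcal{BC}(\alpha)$ is the class of $f\in\mathcal{B}$ with $f'(z)\neq0$ on $\mathbb{D}\setminus\{0\}$ and $\operatorname{Re}\left(1+\frac{zf''(z)}{f'(z)}\right)\le -\alpha$ for $z\in\mathbb{D}\setminus\{0\}$ (meromorphically convex functions of order $\alpha$). For $\gamma\ge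 0$, $\mathcal{P}(\gamma)$ is the class of continuous functions $q:[0,1)\to\mathbb{R}$ such that (a) $q(r)\ge0$ for all $r\in[0,1)$, and (b) the solution $y$ of $y''+qy=0$, $y(0)=0$, $y'(0)=1$, is positive on $(0,1)$ and satisfies $\lim_{x\to1^-} \frac{y'(x)}{y(x)}\ge\gamma$. *)

(* Defs.v *)
From Stdlib Require Import Reals ClassicalEpsilon.
From Coquelicot Require Import Coquelicot.

(* Complex derivative of f at z (chosen by classical description; it is the
   genuine complex derivative whenever f is complex-differentiable at z). *)
Definition Cderive (f : C -> C) (z : C) : C :=
  epsilon (inhabits (RtoC 0)) (fun l : C => is_derive (K := C_AbsRing) f z l).

Definition punctured_disk (z : C) : Prop := z <> 0%C /\ Cmod z < 1.

Definition class_B (f : C -> C) : Prop :=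
  exists a : nat -> C, forall z, punctured_disk z ->
    is_pseries (K := C_AbsRing) a z (f z - / z)%C.

Definition locally_univalent (f : C -> C) : Prop :=
  forall z, punctured_disk z -> Cderive f z <> 0%C.

Definition pre_schwarzian (f : C -> C) (z : C) : C :=
  (Cderive (Cderive f) z / Cderive f z)%C.

Definition schwarzian (f : C -> C) (z : C) : C :=
  (Cderive (pre_schwarzian f) z
    - / 2 * (pre_schwarzian f z * pre_schwarzian f z))%C.

Definition class_BC (alpha : R) (f : C -> C) : Prop :=
  class_B f /\ locally_univalent f /\
  forall z, punctured_disk z ->
    (Re (1 + z * (Cderive (Cderive f) z / Cderive f z))%C <= - alpha)%R.

Definition class_P (gamma : R) (q : R -> R) : Prop :=
  (forall x, 0 <= x < 1 ->
     filterlim q (within (fun t => 0 <= t < 1) (locally x)) (locally (q x)))%R /\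
  (forall r, 0 <= r < 1 -> 0 <= q r)%R /\
  exists y dy : R -> R,
    y 0%R = 0%R /\ dy 0%R = 1%R /\
    filterlim y (at_right 0) (locally 0%R) /\
    filterlim dy (at_right 0) (locally 1%R) /\
    (forall x, 0 < x < 1 -> is_derive y x (dy x))%R /\
    (forall x, 0 < x < 1 -> is_derive dy x (- q x * y x))%R /\
    (forall x, 0 < x < 1 -> 0 < y x)%R /\
    exists L : Rbar,
      filterlim (fun x => dy x / y x)%R (at_left 1) (Rbar_locally L) /\
      Rbar_le (Finite gamma) L.

(* Main.v *)
(** Along a ray [z = r c] the function [A(r) = Re (- c f''/f' / 2)] satisfies the Riccati
    inequality [A' >= - A^2 - q], while [Y = y'/y] solves [Y' = - Y^2 - q] with the same pole at
    [0]; hence [A >= Y]. Since [Y] decreases to a limit [>= (1 + alpha)/2], this gives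
    [Re (1 + z f''/f') <= 1 - r (1 + alpha)] on the circle [|z| = r]. The left-hand side is harmonic
    in the whole disk, so the maximum principle and [r -> 1] give the bound [- alpha].
    For sharpness take [q = k^2] and [f = k cot(kz)] with [k cot k = beta], where [S_f = 2 k^2]. The
    Laurent coefficients of [f] are obtained from the Riccati equation [f' = - k^2 - f^2]. *)

Require Import Defs.
From Stdlib Require Import Reals Lra Lia ClassicalEpsilon.
From Coquelicot Require Import Coquelicot.
Local Open Scope R_scope.

Local Notation is_C_derive := (@is_derive C_AbsRing C_NormedModule).
Local Notation is_C_series := (@is_series C_AbsRing C_NormedModule).

(* [ring] and [field] do not see through the canonical-structure carriers of [C]. *)
Local Ltac C_eq := match goal with |- @eq _ ?u ?v => change (@eq C u v) end.

(** * Complex derivatives *)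

(** Along the ray, w = - c f''/f' / 2 satisfies w' = - w^2 - c^2 S_f / 2. Its real part A obeys only
    an inequality because Re (w^2) = A^2 - (Im w)^2, and the square of Im w is discarded. The bound
    obtained on |z| = r reaches - alpha only as r -> 1, so the ray through a given z is not enough
    by itself: the estimate has to be carried inward from circles close to the unit circle. The pole
    is absorbed in g = z^2 f', which is analytic and nonzero on the whole disk. Then f''/f' = g'/g -
    2/z, and z f''/f' = z g'/g - 2 makes sense at 0. In the sharpness example the comparison is an
    equality on the positive real axis, where A = f = y'/y = k cot(kx). The Laurent series must
    converge on the whole disk; the coefficient estimate covers k^2 < 3, and k <= PI/2 stays within
    this range. *)

Lemma is_derive_C_iff (f : C -> C) (z l : C) :
  is_C_derive f z l <->
  forall eps : R, 0 < eps -> exists d, 0 < d /\ forall w, Cmod (w - z) < d ->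
    Cmod (f w - f z - (w - z) * l) <= eps * Cmod (w - z).
Proof.
  split.
  - intros [_ H] eps He.
    destruct (H z (fun P HP => HP) (mkposreal eps He)) as [d Hd].
    exists d; split; [apply cond_pos|]. intros w Hw. exact (Hd w Hw).
  - intros H; split.
    + apply @is_linear_scal_l.
    + intros x Hx eps.
      rewrite <- (@is_filter_lim_locally_unique C_AbsRing (AbsRing_NormedModule C_AbsRing) _ _ Hx).
      destruct (H eps (cond_pos eps)) as [d [Hd1 Hd]].
      exists (mkposreal d Hd1). intros w Hw. exact (Hd w Hw).
Qed.

(** The complex numbers carry two normed-module structures: the one used for [is_C_derive], and the
    ring over itself, in which the identity and product rules are stated. The remainder estimates of
    the two notions coincide. *)
Lemma is_derive_C_regular (f : C -> C) (z l : C) :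
  is_C_derive f z l <->
  is_derive (K := C_AbsRing) (V := AbsRing_NormedModule C_AbsRing) f z l.
Proof.
  split; intros [_ H]; (split; [apply @is_linear_scal_l|exact H]).
Qed.

Lemma Cderive_unique (f : C -> C) (z l : C) :
  is_C_derive f z l -> Cderive f z = l.
Proof.
  intros H. unfold Cderive.
  rewrite <- (is_C_derive_unique f z l H). symmetry. apply is_C_derive_unique.
  apply (epsilon_spec (inhabits (RtoC 0))
    (fun l : C => is_C_derive f z l)). now exists l.
Qed.

Lemma is_C_derive_const (c z : C) : is_C_derive (fun _ => c) z (RtoC 0).
Proof. exact (@is_derive_const C_AbsRing C_NormedModule c z). Qed.

Lemma is_C_derive_id (z : C) : is_C_derive (fun w => w) z (RtoC 1).
Proof. rewrite is_derive_C_regular. exact (@is_derive_id C_AbsRing z). Qed.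

Lemma is_C_derive_plus (f g : C -> C) (z a b : C) :
  is_C_derive f z a -> is_C_derive g z b ->
  is_C_derive (fun w => f w + g w)%C z (a + b)%C.
Proof. exact (@is_derive_plus C_AbsRing C_NormedModule f g z a b). Qed.

Lemma is_C_derive_minus (f g : C -> C) (z a b : C) :
  is_C_derive f z a -> is_C_derive g z b ->
  is_C_derive (fun w => f w - g w)%C z (a - b)%C.
Proof. exact (@is_derive_minus C_AbsRing C_NormedModule f g z a b). Qed.

Lemma is_C_derive_mult (f g : C -> C) (z a b : C) :
  is_C_derive f z a -> is_C_derive g z b ->
  is_C_derive (fun w => f w * g w)%C z (a * g z + f z * b)%C.
Proof.
  rewrite !is_derive_C_regular. intros Hf Hg.
  exact (@is_derive_mult C_AbsRing f g z a b Hf Hg Cmult_comm).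
Qed.

Lemma is_C_derive_continuous (f : C -> C) (z l : C) :
  is_C_derive f z l ->
  forall eps, 0 < eps -> exists d, 0 < d /\ forall w, Cmod (w - z) < d ->
    Cmod (f w - f z) < eps.
Proof.
  rewrite is_derive_C_iff. intros H eps He.
  destruct (H 1 Rlt_0_1) as [d [Hd Hb]].
  pose proof (Cmod_ge_0 l) as Hl.
  assert (Hp : 0 < eps / (2 + Cmod l)) by (apply Rdiv_lt_0_compat; lra).
  exists (Rmin d (eps / (2 + Cmod l))). split; [now apply Rmin_pos|].
  intros w Hw.
  pose proof (Rlt_le_trans _ _ _ Hw (Rmin_l _ _)) as H1.
  pose proof (Rlt_le_trans _ _ _ Hw (Rmin_r _ _)) as H2.
  specialize (Hb w H1).
  replace (f w - f z)%C with ((f w - f z - (w - z) * l) + (w - z) * l)%C by ring.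
  eapply Rle_lt_trans; [apply Cmod_triangle|]. rewrite Cmod_mult.
  assert (Cmod (w - z) * (2 + Cmod l) < eps).
  { apply Rlt_div_r in H2; lra. }
  pose proof (Cmod_ge_0 (w - z)). nra.
Qed.

Lemma Cmod_minus_le (x y : C) : Cmod x <= Cmod (y - x) + Cmod y.
Proof.
  replace x with (- (y - x) + y)%C at 1 by ring.
  eapply Rle_trans; [apply Cmod_triangle|]. rewrite Cmod_opp. lra.
Qed.

Lemma is_C_derive_inv (f : C -> C) (z l : C) :
  is_C_derive f z l -> f z <> 0%C ->
  is_C_derive (fun w => / f w)%C z (- l / (f z * f z))%C.
Proof.
  intros Hf Hz. pose proof (is_C_derive_continuous f z l Hf) as Hc.
  rewrite is_derive_C_iff in Hf |- *. intros eps He.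
  set (m := Cmod (f z)). assert (Hm : 0 < m) by now apply Cmod_gt_0.
  pose proof (Cmod_ge_0 l) as Hl.
  (* The numerator of the error splits into two terms and the denominator is at least m^3/2, so each
     term may use eps m^3/4 times |w - z|. [e1] pays for the first, the second entry of [e2] for the
     other, and the entry m/2 keeps |f w| above m/2. *)
  set (e1 := eps * (m * m) / 4). set (e2 := Rmin (m / 2) (eps * (m * m * m) / (4 * (Cmod l + 1)))).
  assert (He1 : 0 < e1) by (unfold e1; assert (0 < m * m) by nra; nra).
  assert (Hq : 0 < eps * (m * m * m) / (4 * (Cmod l + 1))).
  { apply Rdiv_lt_0_compat; [|lra]. repeat apply Rmult_lt_0_compat; lra. }
  assert (He2 : 0 < e2) by (apply Rmin_pos; lra).
  destruct (Hf e1 He1) as [d1 [Hd1 H1]]. destruct (Hc e2 He2) as [d2 [Hd2 H2]].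
  exists (Rmin d1 d2). split; [now apply Rmin_pos|]. intros w Hw.
  specialize (H1 w (Rlt_le_trans _ _ _ Hw (Rmin_l _ _))).
  specialize (H2 w (Rlt_le_trans _ _ _ Hw (Rmin_r _ _))).
  assert (Ha : Cmod (f w - f z) < m / 2) by (eapply Rlt_le_trans; [exact H2|apply Rmin_l]).
  assert (Hb : Cmod (f w - f z) * (4 * (Cmod l + 1)) < eps * (m * m * m)).
  { apply Rlt_div_r; [lra|]. eapply Rlt_le_trans; [exact H2|apply Rmin_r]. }
  assert (Hmw : m / 2 < Cmod (f w)).
  { pose proof (Cmod_minus_le (f z) (f w)). fold m in H. lra. }
  assert (Hw0 : f w <> 0%C) by (apply Cmod_gt_0; lra).
  set (h := Cmod (w - z)) in *. assert (Hh : 0 <= h) by apply Cmod_ge_0.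
  replace (/ f w - / f z - (w - z) * (- l / (f z * f z)))%C
    with ((- (f w - f z - (w - z) * l) * f z + (w - z) * l * (f w - f z))
           / (f w * (f z * f z)))%C by (field; now split).
  rewrite Cmod_div by (apply Cmult_neq_0; [|apply Cmult_neq_0]; assumption).
  rewrite !Cmod_mult. fold m.
  apply Rle_div_l. { apply Rlt_gt. repeat apply Rmult_lt_0_compat; lra. }
  eapply Rle_trans; [apply Cmod_triangle|]. rewrite !Cmod_mult, Cmod_opp. fold m h.
  set (X := Cmod (f w - f z - (w - z) * l)) in *. set (Y := Cmod (f w - f z)) in *.
  set (W := Cmod (f w)) in *. set (L := Cmod l) in *.
  assert (0 <= Y) by apply Cmod_ge_0.
  assert (X * m <= eps * (m * m * m) / 4 * h).
  { apply Rle_trans with (e1 * h * m); [apply Rmult_le_compat_r; lra|unfold e1; lra]. }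
  assert (L * Y <= eps * (m * m * m) / 4) by nra.
  assert (h * L * Y <= eps * (m * m * m) / 4 * h) by nra.
  assert (eps * h * (m / 2 * (m * m)) <= eps * h * (W * (m * m))).
  { apply Rmult_le_compat_l; [nra|]. apply Rmult_le_compat_r; nra. }
  lra.
Qed.

Lemma is_C_derive_div (f g : C -> C) (z a b : C) :
  is_C_derive f z a -> is_C_derive g z b -> g z <> 0%C ->
  is_C_derive (fun w => f w / g w)%C z (a / g z - f z / g z * (b / g z))%C.
Proof.
  intros Hf Hg Hz.
  replace (a / g z - f z / g z * (b / g z))%C
    with (a * / g z + f z * (- b / (g z * g z)))%C by (field; assumption).
  apply (is_C_derive_mult f (fun w => / g w)%C); [assumption|].
  now apply is_C_derive_inv.
Qed.

Lemma is_C_derive_ext_near (f g : C -> C) (z l : C) :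
  (exists d, 0 < d /\ forall w, Cmod (w - z) < d -> f w = g w) ->
  is_C_derive f z l -> is_C_derive g z l.
Proof.
  intros [d [Hd H]]. apply is_derive_ext_loc.
  exists (mkposreal d Hd). intros w Hw. apply H. exact Hw.
Qed.

Lemma punctured_disk_open (z : C) : punctured_disk z ->
  exists d, 0 < d /\ forall w, Cmod (w - z) < d -> punctured_disk w.
Proof.
  intros [Hz H1]. apply Cmod_gt_0 in Hz.
  exists (Rmin (Cmod z) (1 - Cmod z)). split; [apply Rmin_pos; lra|].
  intros w Hw. pose proof (Rmin_l (Cmod z) (1 - Cmod z)). pose proof (Rmin_r (Cmod z) (1 - Cmod z)).
  split.
  - apply Cmod_gt_0. pose proof (Cmod_minus_le z w). lra.
  - replace w with ((w - z) + z)%C by ring. eapply Rle_lt_trans; [apply Cmod_triangle|]. lra.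
Qed.

Lemma is_C_derive_ext_punctured (f g : C -> C) (z l : C) :
  (forall w, punctured_disk w -> f w = g w) -> punctured_disk z ->
  is_C_derive f z l -> is_C_derive g z l.
Proof.
  intros H Hz. apply is_C_derive_ext_near.
  destruct (punctured_disk_open z Hz) as [d [Hd Hw]]. exists d; split; auto.
Qed.

Lemma Re_le_Cmod (z : C) : Re z <= Cmod z.
Proof. eapply Rle_trans; [apply Rle_abs|apply re_le_Cmod]. Qed.

(* The factor [e] makes this cover both real and imaginary parts. *)
Lemma is_derive_Re_line (F : C -> C) (z0 c e : C) (t : R) (l : C) :
  is_C_derive F (z0 + t * c)%C l ->
  is_derive (fun s : R => Re (e * F (z0 + s * c)%C)) t (Re (e * (c * l))).
Proof.
  rewrite is_derive_C_iff. intros H. split; [apply @is_linear_scal_l|].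
  intros x Hx eps.
  rewrite <- (is_filter_lim_locally_unique _ _ Hx). clear x Hx.
  set (m := (Cmod e + 1) * (Cmod c + 1)).
  pose proof (Cmod_ge_0 e) as He0. pose proof (Cmod_ge_0 c) as Hc0.
  assert (Hm : 0 < m) by (unfold m; nra).
  assert (Hp : 0 < eps / m) by (apply Rdiv_lt_0_compat; [apply cond_pos|assumption]).
  destruct (H _ Hp) as [d [Hd Hw]].
  assert (Hd' : 0 < d / (Cmod c + 1)) by (apply Rdiv_lt_0_compat; lra).
  exists (mkposreal _ Hd'). intros s Hs.
  change (Rabs (s - t) < d / (Cmod c + 1)) in Hs.
  change (Rabs (Re (e * F (z0 + s * c)%C) - Re (e * F (z0 + t * c)%C)
           - (s - t) * Re (e * (c * l))) <= eps * Rabs (s - t)).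
  specialize (Hw (z0 + s * c)%C).
  replace (z0 + s * c - (z0 + t * c))%C with (RtoC (s - t) * c)%C in Hw
    by (rewrite RtoC_minus; ring).
  rewrite !Cmod_mult, !Cmod_R in Hw.
  pose proof (Rabs_pos (s - t)) as Ha.
  apply Rlt_div_r in Hs; [|lra].
  assert (Hk : Rabs (s - t) * Cmod c < d) by nra.
  specialize (Hw Hk).
  set (X := (F (z0 + s * c) - F (z0 + t * c) - RtoC (s - t) * c * l)%C) in *.
  replace (Re (e * F (z0 + s * c)%C) - Re (e * F (z0 + t * c)%C)
           - (s - t) * Re (e * (c * l))) with (Re (e * X)).
  2:{ unfold X, Re. simpl. ring. }
  eapply Rle_trans; [apply re_le_Cmod|]. rewrite Cmod_mult.
  apply Rle_trans with (Cmod e * (eps / m * (Rabs (s - t) * Cmod c))).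
  { apply Rmult_le_compat_l; assumption. }
  replace (Cmod e * (eps / m * (Rabs (s - t) * Cmod c)))
    with (eps * Rabs (s - t) * ((Cmod e * Cmod c) / m)) by (field; lra).
  rewrite <- (Rmult_1_r (eps * Rabs (s - t))) at 2.
  apply Rmult_le_compat_l.
  { apply Rmult_le_pos; [left; apply cond_pos|assumption]. }
  apply Rle_div_l; [lra|]. unfold m. nra.
Qed.

(** * Complex power series *)

Lemma sum_n_C (x : nat -> C) (n : nat) :
  @sum_n C_AbelianMonoid x n = (sum_n (fun k => Re (x k)) n, sum_n (fun k => Im (x k)) n).
Proof.
  induction n as [|n IH].
  - rewrite !sum_O. now destruct (x O).
  - rewrite !sum_Sn, IH. reflexivity.
Qed.

Lemma is_C_series_iff (x : nat -> C) (l : C) :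
  is_C_series x l <->
  is_series (fun n => Re (x n)) (Re l) /\ is_series (fun n => Im (x n)) (Im l).
Proof.
  assert (E : forall n, sum_n (G := C_NormedModule) x n
    = (sum_n (fun k => Re (x k)) n, sum_n (fun k => Im (x k)) n)) by (intros n; apply sum_n_C).
  pose proof (@filterlim_locally _ C_UniformSpace eventually _
    (sum_n (G := C_NormedModule) x) l) as EC.
  pose proof (@filterlim_locally _ R_UniformSpace eventually _
    (sum_n (fun k => Re (x k))) (Re l)) as ER.
  pose proof (@filterlim_locally _ R_UniformSpace eventually _
    (sum_n (fun k => Im (x k))) (Im l)) as EI.
  split.
  - intros H. pose proof (proj1 EC H) as HC. split; [apply (proj2 ER)|apply (proj2 EI)];
      intros eps; generalize (HC eps); apply filter_imp; intros n;
      rewrite E; intros [H1 H2]; assumption.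
  - intros [H1 H2]. apply (proj2 EC). intros eps.
    generalize (filter_and _ _ (proj1 ER H1 eps) (proj1 EI H2 eps)).
    apply filter_imp. intros n [P Q]. rewrite E. now split.
Qed.

Definition CSeries (x : nat -> C) : C :=
  (Series (fun n => Re (x n)), Series (fun n => Im (x n))).

Lemma CSeries_unique (x : nat -> C) (l : C) : is_C_series x l -> CSeries x = l.
Proof.
  rewrite is_C_series_iff. intros [H1 H2]. unfold CSeries.
  rewrite (is_series_unique _ _ H1), (is_series_unique _ _ H2). now destruct l.
Qed.

Lemma im_le_Cmod (z : C) : Rabs (Im z) <= Cmod z.
Proof. eapply Rle_trans; [apply Rmax_r|apply (Rmax_Cmod z)]. Qed.

Lemma CSeries_correct (x : nat -> C) :
  ex_series (fun n => Cmod (x n)) -> is_C_series x (CSeries x).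
Proof.
  intros H. apply is_C_series_iff. split; apply Series_correct.
  - apply (ex_series_le (K := R_AbsRing) (V := R_CompleteNormedModule) _ (fun n => Cmod (x n))); [|assumption].
    intros n. apply re_le_Cmod.
  - apply (ex_series_le (K := R_AbsRing) (V := R_CompleteNormedModule) _ (fun n => Cmod (x n))); [|assumption].
    intros n. apply im_le_Cmod.
Qed.

Lemma is_C_series_minus (x y : nat -> C) (lx ly : C) :
  is_C_series x lx -> is_C_series y ly -> is_C_series (fun n => x n - y n)%C (lx - ly)%C.
Proof. exact (@is_series_minus C_AbsRing C_NormedModule x y lx ly). Qed.

Lemma is_C_series_plus (x y : nat -> C) (lx ly : C) :
  is_C_series x lx -> is_C_series y ly -> is_C_series (fun n => x n + y n)%C (lx + ly)%C.
Proof. exact (@is_series_plus C_AbsRing C_NormedModule x y lx ly). Qed.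

Lemma is_C_series_scal (c : C) (x : nat -> C) (l : C) :
  is_C_series x l -> is_C_series (fun n => c * x n)%C (c * l)%C.
Proof. exact (@is_series_scal C_AbsRing C_NormedModule c x l). Qed.

Lemma is_C_series_shift (x : nat -> C) (l : C) :
  x O = 0%C -> is_C_series x l -> is_C_series (fun n => x (S n)) l.
Proof.
  intros H0 H. apply (@is_series_incr_1 C_AbsRing C_NormedModule). rewrite H0.
  change (is_C_series x (l + 0)%C). now rewrite Cplus_0_r.
Qed.

Lemma is_C_series_Cmod_le (x : nat -> C) (y : nat -> R) (l : C) (m : R) :
  (forall n, Cmod (x n) <= y n) -> is_C_series x l -> is_series y m -> Cmod l <= m.
Proof.
  intros Hle Hx Hy.
  apply (is_lim_seq_le (fun n => Cmod (sum_n (G := C_NormedModule) x n)) (sum_n y) (Cmod l) m).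
  - intros n. unfold sum_n. eapply Rle_trans.
    + apply (@norm_sum_n_m C_AbsRing C_NormedModule).
    + apply sum_n_m_le. exact Hle.
  - apply (filterlim_comp _ _ _ (sum_n (G := C_NormedModule) x) (@norm _ C_NormedModule) _ _ _ Hx).
    apply (@filterlim_norm C_AbsRing C_NormedModule).
  - exact Hy.
Qed.

(* Reduces to the real Cauchy product for the four products of real and imaginary parts. *)
Lemma is_C_series_mult (x y : nat -> C) (lx ly : C) :
  is_C_series x lx -> is_C_series y ly ->
  ex_series (fun n => Cmod (x n)) -> ex_series (fun n => Cmod (y n)) ->
  is_C_series (fun n => @sum_n C_AbelianMonoid (fun k => x k * y (n - k)%nat)%C n) (lx * ly)%C.
Proof.
  rewrite !is_C_series_iff. intros [Hxr Hxi] [Hyr Hyi] Ax Ay.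
  assert (Ar : forall u, ex_series (fun n => Cmod (u n)) -> ex_series (fun n => Rabs (Re (u n)))).
  { intros u Hu. apply (ex_series_le (K := R_AbsRing) (V := R_CompleteNormedModule) _ (fun n => Cmod (u n))); [|assumption].
    intros n. change (Rabs (Rabs (Re (u n))) <= Cmod (u n)). rewrite Rabs_Rabsolu. apply re_le_Cmod. }
  assert (Ai : forall u, ex_series (fun n => Cmod (u n)) -> ex_series (fun n => Rabs (Im (u n)))).
  { intros u Hu. apply (ex_series_le (K := R_AbsRing) (V := R_CompleteNormedModule) _ (fun n => Cmod (u n))); [|assumption].
    intros n. change (Rabs (Rabs (Im (u n))) <= Cmod (u n)). rewrite Rabs_Rabsolu. apply im_le_Cmod. }
  pose proof (is_series_mult _ _ _ _ Hxr Hyr (Ar _ Ax) (Ar _ Ay)) as Hrr.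
  pose proof (is_series_mult _ _ _ _ Hxi Hyi (Ai _ Ax) (Ai _ Ay)) as Hii.
  pose proof (is_series_mult _ _ _ _ Hxr Hyi (Ar _ Ax) (Ai _ Ay)) as Hri.
  pose proof (is_series_mult _ _ _ _ Hxi Hyr (Ai _ Ax) (Ar _ Ay)) as Hir.
  split.
  - eapply is_series_ext; [|exact (is_series_minus _ _ _ _ Hrr Hii)].
    intros n. rewrite sum_n_C. unfold Re at 3, fst at 1. rewrite sum_n_Reals.
    match goal with |- plus ?a (opp ?b) = _ => change (a - b = sum_f_R0
      (fun k => Re (x k) * Re (y (n - k)%nat) - Im (x k) * Im (y (n - k)%nat)) n) end.
    now rewrite minus_sum.
  - eapply is_series_ext; [|exact (is_series_plus _ _ _ _ Hri Hir)].
    intros n. rewrite sum_n_C. unfold Im at 3, snd at 1. rewrite sum_n_Reals.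
    match goal with |- plus ?a ?b = _ => change (a + b = sum_f_R0
      (fun k => Re (x k) * Im (y (n - k)%nat) + Im (x k) * Re (y (n - k)%nat)) n) end.
    now rewrite plus_sum.
Qed.

Definition CPS (a : nat -> C) (z : C) : C := CSeries (fun n => a n * z ^ n)%C.

Definition CPS_derive (a : nat -> C) (n : nat) : C := (RtoC (INR (S n)) * a (S n))%C.

(** Convergence inside the disk is absolute, so passing to moduli loses nothing and makes the theory
    of real power series applicable. *)
Definition C_CV_radius (a : nat -> C) : Rbar := CV_radius (fun n => Cmod (a n)).

Lemma C_CV_radius_derive (a : nat -> C) : C_CV_radius (CPS_derive a) = C_CV_radius a.
Proof.
  unfold C_CV_radius. rewrite <- (CV_radius_derive (fun n => Cmod (a n))). apply CV_radius_ext. intros n.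
  unfold CPS_derive, PS_derive. rewrite Cmod_mult, Cmod_R, Rabs_pos_eq by apply pos_INR. reflexivity.
Qed.

Lemma ex_series_CPS_abs (a : nat -> C) (r : R) :
  Rbar_le 1 (C_CV_radius a) -> 0 <= r < 1 -> ex_series (fun n => Cmod (a n) * r ^ n).
Proof.
  intros Ha [H0 H1].
  eapply ex_series_ext; [|apply (CV_disk_inside (fun n => Cmod (a n)) r)].
  - intros n. apply Rabs_pos_eq. apply Rmult_le_pos; [apply Cmod_ge_0|now apply pow_le].
  - rewrite Rabs_pos_eq by assumption. eapply Rbar_lt_le_trans; [|exact Ha]. exact H1.
Qed.

Lemma CPS_correct (a : nat -> C) (z : C) :
  Rbar_le 1 (C_CV_radius a) -> Cmod z < 1 -> is_C_series (fun n => a n * z ^ n)%C (CPS a z).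
Proof.
  intros Ha Hz. apply CSeries_correct.
  eapply ex_series_ext; [|apply (ex_series_CPS_abs a (Cmod z) Ha)].
  - intros n. simpl. now rewrite Cmod_mult, Cmod_pow.
  - split; [apply Cmod_ge_0|assumption].
Qed.

Lemma pow_n_Cpow (z : C) (n : nat) : @pow_n C_Ring z n = (z ^ n)%C.
Proof. induction n as [|n IH]; [reflexivity|]. simpl. rewrite IH. reflexivity. Qed.

Lemma is_pseries_C_iff (a : nat -> C) (z l : C) :
  is_pseries (K := C_AbsRing) (V := C_NormedModule) a z l
  <-> is_C_series (fun n => a n * z ^ n)%C l.
Proof.
  unfold is_pseries.
  assert (E : forall n, @scal _ C_NormedModule (@pow_n C_AbsRing z n) (a n) = (a n * z ^ n)%C).
  { intros n. change (@pow_n C_Ring z n * a n = a n * z ^ n)%C. rewrite pow_n_Cpow. ring. }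
  split; apply is_series_ext; intros n; [apply E|symmetry; apply E].
Qed.

Lemma C_CV_radius_ge_1 (a : nat -> C) :
  (forall r, 0 < r < 1 -> exists M, forall n, Cmod (a n) * r ^ n <= M) ->
  Rbar_le 1 (C_CV_radius a).
Proof.
  intros H. destruct (CV_radius_bounded (fun n => Cmod (a n))) as [Hub _].
  fold (C_CV_radius a) in Hub.
  assert (K : forall r, 0 < r < 1 -> Rbar_le r (C_CV_radius a)).
  { intros r Hr. apply Hub. destruct (H r Hr) as [M HM]. exists M. intros n.
    rewrite Rabs_pos_eq; [apply HM|]. apply Rmult_le_pos; [apply Cmod_ge_0|apply pow_le; lra]. }
  destruct (C_CV_radius a) as [x| |].
  - simpl. apply Rnot_lt_le. intros Hx.
    assert (Hx2 : 0 < x). { specialize (K (1/2) ltac:(lra)). simpl in K. lra. }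
    specialize (K ((1 + x) / 2) ltac:(lra)). simpl in K. lra.
  - exact I.
  - exact (K (1/2) ltac:(lra)).
Qed.

(** A term of a convergent series is the difference of two consecutive partial sums, hence bounded
    by twice a bound for those sums. Real points in (0,1) suffice. *)
Lemma C_CV_radius_of_convergence (a : nat -> C) :
  (forall z, punctured_disk z -> exists l, is_C_series (fun n => a n * z ^ n)%C l) ->
  Rbar_le 1 (C_CV_radius a).
Proof.
  intros H. apply C_CV_radius_ge_1. intros r Hr.
  destruct (H (RtoC r)) as [l Hl].
  { split; [apply Cmod_gt_0|]; rewrite Cmod_R, Rabs_pos_eq; lra. }
  destruct (@filterlim_bounded C_AbsRing C_NormedModule _ (ex_intro _ l Hl)) as [M HM].
  exists (2 * M). intros n.
  replace (Cmod (a n) * r ^ n) with (Cmod (a n * RtoC r ^ n)).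
  2:{ rewrite Cmod_mult, Cmod_pow, Cmod_R, Rabs_pos_eq by lra. reflexivity. }
  set (x := fun n => (a n * RtoC r ^ n)%C) in *. change (Cmod (x n) <= 2 * M).
  change (forall n, Cmod (@sum_n C_AbelianMonoid x n) <= M) in HM.
  pose proof (Rle_trans _ _ _ (Cmod_ge_0 _) (HM O)) as HM0.
  destruct n as [|n].
  - specialize (HM O). rewrite sum_O in HM. lra.
  - pose proof (HM n) as H1. pose proof (HM (S n)) as H2. rewrite sum_Sn in H2.
    change (@plus ?G ?u ?v) with (u + v)%C in H2.
    replace (x (S n)) with ((sum_n (G := C_AbelianMonoid) x n + x (S n))
       + - (sum_n (G := C_AbelianMonoid) x n))%C by ring.
    eapply Rle_trans; [apply Cmod_triangle|]. rewrite Cmod_opp. lra.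
Qed.

(* The remainders satisfy [e_(n+1) = w e_n + n z^(n-1) (w - z)^2]. *)
Lemma Cpow_taylor (z w : C) (rho : R) (n : nat) :
  Cmod z <= rho -> Cmod w <= rho ->
  Cmod (w ^ S (S n) - z ^ S (S n) - RtoC (INR (S (S n))) * z ^ S n * (w - z))
  <= INR (S (S n)) * INR (S n) * rho ^ n * (Cmod (w - z) * Cmod (w - z)).
Proof.
  intros Hz Hw. pose proof (Cmod_ge_0 z) as Hz0.
  set (D := Cmod (w - z) * Cmod (w - z)).
  assert (HD : 0 <= D) by (unfold D; pose proof (Cmod_ge_0 (w - z)); nra).
  induction n as [|n IH].
  - replace (w ^ 2 - z ^ 2 - RtoC (INR 2) * z ^ 1 * (w - z))%C with ((w - z) * (w - z))%C.
    2:{ simpl INR. rewrite RtoC_plus. ring. }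
    rewrite Cmod_mult. fold D. simpl. lra.
  - replace (w ^ S (S (S n)) - z ^ S (S (S n)) - RtoC (INR (S (S (S n)))) * z ^ S (S n) * (w - z))%C
      with (w * (w ^ S (S n) - z ^ S (S n) - RtoC (INR (S (S n))) * z ^ S n * (w - z))
            + RtoC (INR (S (S n))) * z ^ S n * ((w - z) * (w - z)))%C.
    2:{ rewrite (S_INR (S (S n))), RtoC_plus, !Cpow_S. ring. }
    eapply Rle_trans; [apply Cmod_triangle|]. rewrite !Cmod_mult, Cmod_R, Cmod_pow. fold D.
    rewrite Rabs_pos_eq by apply pos_INR.
    set (E := Cmod (w ^ S (S n) - z ^ S (S n) - RtoC (INR (S (S n))) * z ^ S n * (w - z))) in *.
    assert (Hp : Cmod z ^ S n <= rho ^ S n) by (apply pow_incr; lra).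
    assert (HE : 0 <= E) by apply Cmod_ge_0.
    assert (Hr : 0 <= rho ^ n) by (apply pow_le; lra).
    set (p := rho ^ n) in *. change (rho ^ S n) with (rho * p) in *.
    pose proof (pos_INR (S n)) as Hn. rewrite (S_INR (S (S n))), (S_INR (S n)) in *.
    set (m := INR (S n)) in *. set (q := Cmod z ^ S n) in *.
    assert (S1 : Cmod w * E <= rho * ((m + 1) * m * p * D)).
    { apply Rmult_le_compat; [apply Cmod_ge_0|assumption|assumption|assumption]. }
    assert (S2 : (m + 1) * q * D <= (m + 1) * (rho * p) * D).
    { apply Rmult_le_compat_r; [assumption|]. apply Rmult_le_compat_l; lra. }
    assert (S3 : 0 <= (m + 1) * (rho * p) * D).
    { clearbody D. repeat apply Rmult_le_pos; lra. }
    nra.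
Qed.

(** By [Cpow_taylor] the remainder is at most M |w - z|^2, where M sums the twice differentiated
    series of moduli at a radius [rho] strictly between |z| and 1. *)
Lemma is_C_derive_CPS (a : nat -> C) (z : C) :
  Rbar_le 1 (C_CV_radius a) -> Cmod z < 1 ->
  is_C_derive (CPS a) z (CPS (CPS_derive a) z).
Proof.
  intros Ha Hz.
  assert (Ha1 : Rbar_le 1 (C_CV_radius (CPS_derive a))) by now rewrite C_CV_radius_derive.
  assert (Ha2 : Rbar_le 1 (C_CV_radius (CPS_derive (CPS_derive a)))) by now rewrite C_CV_radius_derive.
  set (rho := (1 + Cmod z) / 2). pose proof (Cmod_ge_0 z) as Hz0.
  assert (Hrho : Cmod z < rho < 1) by (unfold rho; lra).
  destruct (ex_series_CPS_abs _ rho Ha2 ltac:(lra)) as [M HM].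
  assert (Hkey : forall w, Cmod (w - z) < rho - Cmod z ->
    Cmod (CPS a w - CPS a z - (w - z) * CPS (CPS_derive a) z) <= M * (Cmod (w - z) * Cmod (w - z))).
  { intros w Hwz.
    assert (Hw : Cmod w < rho).
    { replace w with ((w - z) + z)%C by ring. eapply Rle_lt_trans; [apply Cmod_triangle|]. lra. }
    pose proof (CPS_correct a w Ha ltac:(lra)) as Sw.
    pose proof (CPS_correct a z Ha Hz) as Sz.
    pose proof (CPS_correct _ z Ha1 Hz) as Sd.
    pose proof (is_C_series_scal (w - z)%C _ _ Sd) as Sd'.
    pose proof (is_C_series_minus _ _ _ _ Sw Sz) as Sm.
    (* The terms of index 0 and 1 contribute nothing to the remainder. Dropping them aligns the
       series with the exponents n + 2 of [Cpow_taylor]. *)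
    apply is_C_series_shift in Sm; [|simpl; ring].
    pose proof (is_C_series_minus _ _ _ _ Sm Sd') as S1.
    apply is_C_series_shift in S1; [|unfold CPS_derive; simpl; ring].
    assert (S2 : is_C_series (fun n => a (S (S n)) * (w ^ S (S n) - z ^ S (S n)
                   - RtoC (INR (S (S n))) * z ^ S n * (w - z)))%C
                (CPS a w - CPS a z - (w - z) * CPS (CPS_derive a) z)%C).
    { eapply is_series_ext; [|exact S1]. intros n. unfold CPS_derive. cbv beta.
      C_eq. ring. }
    rewrite (Rmult_comm M).
    eapply is_C_series_Cmod_le; [|exact S2|exact (is_series_scal (Cmod (w - z) * Cmod (w - z)) _ _ HM)].
    intros n. cbv beta. rewrite Cmod_mult.
    pose proof (Cpow_taylor z w rho n ltac:(lra) ltac:(lra)) as HT.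
    unfold CPS_derive. rewrite !Cmod_mult, !Cmod_R, !Rabs_pos_eq by apply pos_INR.
    change (@scal ?K ?V ?u ?v) with (u * v).
    pose proof (Cmod_ge_0 (a (S (S n)))) as Hp.
    apply (Rmult_le_compat_l _ _ _ Hp) in HT. eapply Rle_trans; [exact HT|]. right. ring. }
  apply is_derive_C_iff. intros eps He.
  assert (HM0 : 0 <= Rabs M) by apply Rabs_pos.
  assert (Hq : 0 < eps / (Rabs M + 1)) by (apply Rdiv_lt_0_compat; lra).
  exists (Rmin (rho - Cmod z) (eps / (Rabs M + 1))). split; [apply Rmin_pos; lra|].
  intros w Hw.
  pose proof (Rlt_le_trans _ _ _ Hw (Rmin_l _ _)) as H1.
  pose proof (Rlt_le_trans _ _ _ Hw (Rmin_r _ _)) as H2.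
  specialize (Hkey w H1). apply Rlt_div_r in H2; [|lra].
  eapply Rle_trans; [exact Hkey|].
  pose proof (Cmod_ge_0 (w - z)). pose proof (Rle_abs M). 
  rewrite <- Rmult_assoc. apply Rmult_le_compat_r; [assumption|]. nra.
Qed.

(** * Maximum principle *)

(** If k were positive, [phi1] would grow at rate at least k/2 through 0. Moving right when phi1 0
    >= 0, and left otherwise, then strictly increases [phi] by the mean value theorem. *)
Lemma second_derivative_le_0 (phi phi1 : R -> R) (d k : R) :
  0 < d -> (forall t, Rabs t < d -> is_derive phi t (phi1 t)) -> is_derive phi1 0 k ->
  (forall t, Rabs t < d -> phi t <= phi 0) -> k <= 0.
Proof.
  intros Hd Hphi Hk Hmax. apply Rnot_lt_le. intros Hpos.
  apply is_derive_Reals in Hk.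
  destruct (Hk (k / 2) ltac:(lra)) as [e He].
  assert (Hq : forall t, t <> 0 -> Rabs t < e -> (phi1 t - phi1 0) / t > k / 2).
  { intros t Ht Hte. specialize (He t Ht Hte). rewrite Rplus_0_l in He.
    apply Rabs_def2 in He. lra. }
  set (s := Rmin d e / 2).
  pose proof (Rmin_l d e). pose proof (Rmin_r d e). pose proof (cond_pos e).
  assert (Hmin : 0 < Rmin d e) by (apply Rmin_pos; lra).
  assert (Hs : 0 < s /\ s < d /\ s < e) by (unfold s; lra).
  destruct (Rle_lt_dec 0 (phi1 0)) as [Hs0|Hs0].
  - destruct (MVT_cor2 phi phi1 0 s) as [c [Hc1 Hc2]]; [lra| |].
    { intros c Hc. apply is_derive_Reals, Hphi. rewrite Rabs_pos_eq; lra. }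
    specialize (Hmax s ltac:(rewrite Rabs_pos_eq; lra)).
    specialize (Hq c ltac:(lra) ltac:(rewrite Rabs_pos_eq; lra)).
    assert (k / 2 * c < phi1 c - phi1 0) by (apply Rlt_div_r; lra).
    assert (0 < k / 2 * c) by (apply Rmult_lt_0_compat; lra).
    assert (0 < phi1 c * (s - 0)) by (apply Rmult_lt_0_compat; lra). lra.
  - destruct (MVT_cor2 phi phi1 (- s) 0) as [c [Hc1 Hc2]]; [lra| |].
    { intros c Hc. apply is_derive_Reals, Hphi. rewrite Rabs_left1; lra. }
    specialize (Hmax (- s) ltac:(rewrite Rabs_left; lra)).
    specialize (Hq c ltac:(lra) ltac:(rewrite Rabs_left; lra)).
    assert (phi1 c - phi1 0 < k / 2 * c).
    { replace (phi1 c - phi1 0) with ((phi1 c - phi1 0) / c * c) by (field; lra). nra. }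
    assert (0 < k / 2 * - c) by (apply Rmult_lt_0_compat; lra).
    assert (0 < - phi1 c * (0 - - s)) by (apply Rmult_lt_0_compat; lra). lra.
Qed.

(** The one-variable extreme value theorem is applied twice: on each vertical segment, and then to
    the resulting maximum as a function of x, which is continuous because [F] is uniformly
    continuous on strips. *)
Lemma continuity_2d_max (F : R -> R -> R) (a b c d : R) :
  a <= b -> c <= d -> (forall x y, continuity_2d_pt F x y) ->
  exists x0 y0, forall x y, a <= x <= b -> c <= y <= d -> F x y <= F x0 y0.
Proof.
  intros Hab Hcd HF.
  assert (Hx : forall x, exists y, forall y', c <= y' <= d -> F x y' <= F x y /\ c <= y <= d).
  { intros x. destruct (continuity_ab_maj (F x) c d Hcd) as [y [H1 H2]].
    - intros y _. apply continuity_pt_locally. intros eps.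
      destruct (HF x y eps) as [e He]. exists e. intros v Hv. apply He; [|exact Hv].
      rewrite Rminus_diag, Rabs_R0. apply cond_pos.
    - exists y. auto. }
  set (Y := fun x => epsilon (inhabits 0)
    (fun y => forall y', c <= y' <= d -> F x y' <= F x y /\ c <= y <= d)).
  assert (HY : forall x y', c <= y' <= d -> F x y' <= F x (Y x) /\ c <= Y x <= d).
  { intros x. apply (epsilon_spec (inhabits 0)
      (fun y => forall y', c <= y' <= d -> F x y' <= F x y /\ c <= y <= d)), Hx. }
  destruct (continuity_ab_maj (fun x => F x (Y x)) a b Hab) as [x0 [H1 H2]].
  - intros x _. apply continuity_pt_locally. intros eps.
    destruct (uniform_continuity_2d F (x - 1) (x + 1) c d (fun x y _ _ => HF x y) eps) as [e He].
    assert (Hm : 0 < Rmin e 1) by (apply Rmin_pos; [apply cond_pos|lra]).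
    exists (mkposreal _ Hm). intros u Hu.
    assert (Hu' : Rabs (u - x) < Rmin e 1) by exact Hu.
    pose proof (Rlt_le_trans _ _ _ Hu' (Rmin_l _ _)) as Hue.
    pose proof (Rlt_le_trans _ _ _ Hu' (Rmin_r _ _)) as Hu1.
    apply Rabs_def2 in Hu1.
    (* [HY] gives the range of [Y x] only together with some test point of [c,d]; the endpoint [c]
       serves as one. *)
    assert (Hcc : c <= c <= d) by lra.
    destruct (HY x c Hcc) as [_ Hxr]. destruct (HY u c Hcc) as [_ Hur].
    (* Each of the two maximal values is tested against the maximiser of the other, which bounds
       their difference from both sides. *)
    destruct (HY x (Y u) Hur) as [A _]. destruct (HY u (Y x) Hxr) as [B _].
    assert (Hz : forall y, Rabs (y - y) < e) by (intros y; rewrite Rminus_diag, Rabs_R0; apply cond_pos).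
    pose proof (He x (Y u) u (Y u) ltac:(lra) Hur ltac:(lra) Hur Hue (Hz _)) as P.
    pose proof (He x (Y x) u (Y x) ltac:(lra) Hxr ltac:(lra) Hxr Hue (Hz _)) as Q.
    apply Rabs_def2 in P. apply Rabs_def2 in Q. apply Rabs_def1; lra.
  - exists x0, (Y x0). intros x y Hxx Hyy.
    eapply Rle_trans; [apply (HY x y Hyy)|]. now apply H1.
Qed.

(** Radial retraction of the plane onto the closed disk of radius r. Composition with it extends a
    function continuous on the disk to the whole plane, so that a maximum over a square becomes a
    maximum over the disk. *)
Definition clip (r : R) (z : C) : C := (RtoC (r / Rmax r (Cmod z)) * z)%C.

Lemma Cmod_clip (r : R) (z : C) : 0 < r -> Cmod (clip r z) <= r.
Proof.
  intros Hr. unfold clip. rewrite Cmod_mult, Cmod_R.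
  pose proof (Rmax_l r (Cmod z)). pose proof (Rmax_r r (Cmod z)).
  rewrite Rabs_pos_eq by (apply Rlt_le, Rdiv_lt_0_compat; lra).
  replace (r / Rmax r (Cmod z) * Cmod z) with (r * Cmod z / Rmax r (Cmod z)) by (field; lra).
  apply Rle_div_l; [lra|]. nra.
Qed.

Lemma clip_id (r : R) (z : C) : 0 < r -> Cmod z <= r -> clip r z = z.
Proof.
  intros Hr Hz. unfold clip. rewrite Rmax_left by assumption.
  replace (r / r) with 1 by (field; lra). ring.
Qed.

(** Moving the point costs at most |w - z|, as the scaling factor is at most 1; changing the factor
    costs at most |w - z| again, as max(r, |z|) is 1-Lipschitz. *)
Lemma clip_lipschitz (r : R) (z w : C) :
  0 < r -> Cmod (clip r w - clip r z) <= 2 * Cmod (w - z).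
Proof.
  intros Hr. unfold clip.
  pose proof (Rmax_l r (Cmod z)) as A1. pose proof (Rmax_r r (Cmod z)) as A2.
  pose proof (Rmax_l r (Cmod w)) as B1. pose proof (Rmax_r r (Cmod w)) as B2.
  assert (D : Rabs (Rmax r (Cmod z) - Rmax r (Cmod w)) <= Cmod (w - z)).
  { pose proof (Cmod_minus_le z w) as P. pose proof (Cmod_minus_le w z) as Q.
    replace (Cmod (z - w)) with (Cmod (w - z)) in Q
      by (rewrite <- Cmod_opp; f_equal; ring).
    pose proof (Cmod_ge_0 (w - z)).
    unfold Rmax; destruct (Rle_dec r (Cmod z)), (Rle_dec r (Cmod w)); apply Rabs_le; lra. }
  set (mz := Rmax r (Cmod z)) in *. set (mw := Rmax r (Cmod w)) in *.
  replace (RtoC (r / mw) * w - RtoC (r / mz) * z)%C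
    with (RtoC (r / mw) * (w - z) + RtoC (r / mw - r / mz) * z)%C
    by (rewrite RtoC_minus; ring).
  eapply Rle_trans; [apply Cmod_triangle|]. rewrite !Cmod_mult, !Cmod_R.
  pose proof (Cmod_ge_0 (w - z)) as H0. pose proof (Cmod_ge_0 z) as Hz0.
  assert (E1 : Rabs (r / mw) <= 1).
  { rewrite Rabs_pos_eq by (apply Rlt_le, Rdiv_lt_0_compat; lra). apply Rle_div_l; lra. }
  assert (E2 : Rabs (r / mw - r / mz) * Cmod z <= Cmod (w - z)).
  { replace (r / mw - r / mz) with (r / mw * ((mz - mw) / mz)) by (field; lra).
    rewrite Rabs_mult. unfold Rdiv at 2. rewrite (Rabs_mult (mz - mw)).
    rewrite (Rabs_pos_eq (/ mz)) by (apply Rlt_le, Rinv_0_lt_compat; lra).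
    assert (E3 : / mz * Cmod z <= 1).
    { rewrite Rmult_comm. apply Rle_div_l; lra. }
    assert (0 <= / mz * Cmod z).
    { apply Rmult_le_pos; [apply Rlt_le, Rinv_0_lt_compat; lra|assumption]. }
    pose proof (Rabs_pos (mz - mw)). pose proof (Rabs_pos (r / mw)).
    replace (Rabs (r / mw) * (Rabs (mz - mw) * / mz) * Cmod z)
      with (Rabs (r / mw) * (Rabs (mz - mw) * (/ mz * Cmod z))) by ring.
    assert (Rabs (mz - mw) * (/ mz * Cmod z) <= Cmod (w - z)) by nra.
    assert (0 <= Rabs (mz - mw) * (/ mz * Cmod z)) by (apply Rmult_le_pos; assumption).
    nra. }
  nra.
Qed.

Lemma continuous_disk_max (u : C -> R) (r : R) :
  0 < r ->
  (forall z, Cmod z <= r -> forall eps, 0 < eps -> exists d, 0 < d /\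
     forall w, Cmod (w - z) < d -> Rabs (u w - u z) < eps) ->
  exists z0, Cmod z0 <= r /\ forall z, Cmod z <= r -> u z <= u z0.
Proof.
  intros Hr Hu.
  destruct (continuity_2d_max (fun x y => u (clip r (x, y))) (- r) r (- r) r) as [x0 [y0 H]];
    [lra|lra| |].
  - intros x y eps.
    destruct (Hu (clip r (x, y)) (Cmod_clip r _ Hr) eps (cond_pos eps)) as [d [Hd Hw]].
    (* One factor 2 comes from adding the two coordinates, the other from [clip_lipschitz]. *)
    assert (Hd4 : 0 < d / 4) by lra. exists (mkposreal _ Hd4). simpl. intros x' y' Hx Hy.
    apply Hw. eapply Rle_lt_trans; [now apply clip_lipschitz|].
    assert (Cmod ((x', y') - (x, y)) < d / 2); [|lra].
    replace ((x', y') - (x, y))%C with (RtoC (x' - x) + Ci * RtoC (y' - y))%C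
      by (apply injective_projections; simpl; ring).
    eapply Rle_lt_trans; [apply Cmod_triangle|].
    rewrite Cmod_mult, Cmod_Ci, !Cmod_R. lra.
  - exists (clip r (x0, y0)). split; [now apply Cmod_clip|]. intros z Hz.
    rewrite <- (clip_id r z Hr Hz) at 1. destruct z as [x y].
    pose proof (re_le_Cmod (x, y)) as P. pose proof (im_le_Cmod (x, y)) as Q.
    simpl in P, Q. apply H; apply Rabs_le_between; lra.
Qed.

(* Adding [eps |z|^2] makes the Laplacian strictly positive, which excludes interior maxima. *)
Lemma Re_maximum_principle (G G1 G2 : C -> C) (r m : R) :
  0 < r < 1 ->
  (forall z, Cmod z < 1 -> is_C_derive G z (G1 z)) ->
  (forall z, Cmod z < 1 -> is_C_derive G1 z (G2 z)) ->
  (forall z, Cmod z = r -> Re (G z) <= m) ->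
  forall z, Cmod z <= r -> Re (G z) <= m.
Proof.
  intros [Hr0 Hr1] HG HG1 Hm z Hz. apply Rle_plus_epsilon. intros eps Heps.
  set (Q := fun z : C => Re z * Re z + Im z * Im z).
  assert (HQ : forall z, Q z = Cmod z * Cmod z).
  { intros w. pose proof (Cmod2_alt w). unfold Q. nra. }
  set (U := fun z => Re (G z) + eps * Q z).
  destruct (continuous_disk_max U r Hr0) as [z0 [Hz0 Hmax]].
  - intros w Hw e He.
    destruct (is_C_derive_continuous G w _ (HG w ltac:(lra)) (e / 2) ltac:(lra)) as [d [Hd Hc]].
    (* With |v| + |w| <= 4 the term eps |z|^2 varies by at most 4 eps |v - w|, which must stay below
       e/2. *)
    assert (Hp : 0 < e / (8 * (eps + 1))) by (apply Rdiv_lt_0_compat; lra).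
    exists (Rmin d (Rmin 1 (e / (8 * (eps + 1))))). split.
    { repeat apply Rmin_pos; lra. }
    intros v Hv.
    pose proof (Rlt_le_trans _ _ _ Hv (Rmin_l _ _)) as H1.
    pose proof (Rlt_le_trans _ _ _ Hv (Rmin_r _ _)) as H2.
    pose proof (Rlt_le_trans _ _ _ H2 (Rmin_l _ _)) as H3.
    pose proof (Rlt_le_trans _ _ _ H2 (Rmin_r _ _)) as H4.
    apply Rlt_div_r in H4; [|lra].
    unfold U. rewrite !HQ.
    pose proof (Cmod_minus_le w v) as A. pose proof (Cmod_minus_le v w) as B.
    replace (Cmod (w - v)) with (Cmod (v - w)) in B by (rewrite <- Cmod_opp; f_equal; ring).
    pose proof (Cmod_ge_0 w). pose proof (Cmod_ge_0 v). pose proof (Cmod_ge_0 (v - w)).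
    pose proof (re_le_Cmod (G v - G w)) as R1. specialize (Hc v H1).
    assert (R2 : Rabs (Re (G v) - Re (G w)) < e / 2).
    { replace (Re (G v) - Re (G w)) with (Re (G v - G w)) by reflexivity. lra. }
    set (t := Cmod (v - w)) in *. set (a := Cmod v) in *. set (b := Cmod w) in *.
    assert (R3 : Rabs (a * a - b * b) <= t * 4).
    { replace (a * a - b * b) with ((a - b) * (a + b)) by ring. rewrite Rabs_mult.
      apply Rmult_le_compat; try apply Rabs_pos; apply Rabs_le; lra. }
    replace (Re (G v) + eps * (a * a) - (Re (G w) + eps * (b * b)))
      with ((Re (G v) - Re (G w)) + eps * (a * a - b * b)) by ring.
    eapply Rle_lt_trans; [apply Rabs_triang|].
    rewrite Rabs_mult, (Rabs_pos_eq eps) by lra. nra.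
  - assert (HU : Re (G z) <= U z0).
    { eapply Rle_trans; [|apply (Hmax z Hz)]. unfold U. rewrite HQ.
      pose proof (Cmod_ge_0 z). assert (0 <= eps * (Cmod z * Cmod z)) by (repeat apply Rmult_le_pos; lra). lra. }
    destruct (Rle_lt_or_eq_dec _ _ Hz0) as [Hlt|Heq].
    2:{ unfold U in HU. rewrite HQ, Heq in HU. specialize (Hm z0 Heq).
        assert (eps * (r * r) <= eps * 1) by (apply Rmult_le_compat_l; nra). lra. }
    exfalso.
    (* The left side is the second derivative at t = 0 of [U] along t -> z0 + t c, and [U] has an
       interior maximum at [z0]. *)
    assert (Hdir : forall c : C, Cmod c = 1 -> Re (c * (c * G2 z0)) + 2 * eps <= 0).
    { intros c Hc.
      set (b := Re z0 * Re c + Im z0 * Im c).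
      assert (HQc : forall t : R, Q (z0 + t * c)%C = Q z0 + 2 * b * t + t * t).
      { intros t. assert (Q c = 1) by (rewrite HQ, Hc; ring). unfold Q, b, Re, Im in *. simpl. nra. }
      apply (second_derivative_le_0
        (fun t : R => Re (1 * G (z0 + t * c)%C) + eps * (Q z0 + 2 * b * t + t * t))
        (fun t : R => Re (c * G1 (z0 + t * c)%C) + eps * (2 * b + 2 * t)) (r - Cmod z0)); [lra| | |].
      - intros t Ht. apply (is_derive_plus (K := R_AbsRing) (V := R_NormedModule)).
        + replace (Re (c * G1 (z0 + t * c)%C)) with (Re (1 * (c * G1 (z0 + t * c)%C)))
            by (f_equal; ring).
          apply is_derive_Re_line, HG.
          eapply Rle_lt_trans; [apply Cmod_triangle|]. rewrite Cmod_mult, Cmod_R, Hc. lra.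
        + auto_derive; [exact I|ring].
      - apply (is_derive_plus (K := R_AbsRing) (V := R_NormedModule)).
        + replace (G2 z0) with (G2 (z0 + RtoC 0 * c)%C) by (f_equal; ring).
          apply is_derive_Re_line, HG1.
          replace (z0 + RtoC 0 * c)%C with z0 by ring. lra.
        + auto_derive; [exact I|ring].
      - intros t Ht. rewrite !Cmult_1_l.
        replace (z0 + RtoC 0 * c)%C with z0 by ring.
        assert (Hin : Cmod (z0 + t * c) <= r).
        { eapply Rle_trans; [apply Cmod_triangle|]. rewrite Cmod_mult, Cmod_R, Hc. lra. }
        specialize (Hmax _ Hin). unfold U in Hmax. rewrite HQc in Hmax. lra. }
    (* Since i^2 = -1, adding the inequalities for the directions 1 and i cancels [G2] and leaves 4
       eps <= 0. *)
    pose proof (Hdir 1%C Cmod_1) as D1. pose proof (Hdir Ci Cmod_Ci) as D2.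
    rewrite !Cmult_1_l in D1.
    replace (Ci * (Ci * G2 z0))%C with (- G2 z0)%C in D2
      by (apply injective_projections; simpl; ring).
    replace (Re (- G2 z0)) with (- Re (G2 z0)) in D2 by reflexivity. lra.
Qed.

(** * Riccati comparison *)

(** The squared modulus is polynomial in the coordinates, so it is differentiated along rays without
    a square root. *)
Definition Cnorm2 (z : C) : R := Re z * Re z + Im z * Im z.

Lemma Cnorm2_pos (z : C) : z <> 0%C -> 0 < Cnorm2 z.
Proof.
  intros H. apply Cmod_gt_0 in H. pose proof (Cmod2_alt z). unfold Cnorm2. nra.
Qed.

Lemma is_derive_Re_ray (F : C -> C) (c : C) (t : R) (l : C) :
  is_C_derive F (t * c)%C l -> is_derive (fun s : R => Re (F (s * c)%C)) t (Re (c * l)).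
Proof.
  intros H. replace (Re (c * l)) with (Re (1 * (c * l))) by (f_equal; ring).
  apply is_derive_ext with (fun s : R => Re (1 * F (0 + s * c)%C)).
  - intros s. rewrite Cplus_0_l, Cmult_1_l. reflexivity.
  - apply is_derive_Re_line. now rewrite Cplus_0_l.
Qed.

Lemma is_derive_Im_ray (F : C -> C) (c : C) (t : R) (l : C) :
  is_C_derive F (t * c)%C l -> is_derive (fun s : R => Im (F (s * c)%C)) t (Im (c * l)).
Proof.
  assert (E : forall w : C, Re (- Ci * w) = Im w).
  { intros [x y]. unfold Re, Im. simpl. ring. }
  intros H. rewrite <- E.
  apply is_derive_ext with (fun s : R => Re (- Ci * F (0 + s * c)%C)).
  - intros s. rewrite Cplus_0_l, E. reflexivity.
  - apply is_derive_Re_line. now rewrite Cplus_0_l.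
Qed.

(** Here k = g'/g. This gives the radial logarithmic derivative of |g|^2 without a complex
    logarithm. *)
Lemma is_derive_Cnorm2_ray (g : C -> C) (c k : C) (t : R) :
  is_C_derive g (t * c)%C (k * g (t * c))%C ->
  is_derive (fun s : R => Cnorm2 (g (s * c)%C)) t (2 * Re (c * k) * Cnorm2 (g (t * c)%C)).
Proof.
  intros H. pose proof (is_derive_Re_ray _ _ _ _ H) as HR.
  pose proof (is_derive_Im_ray _ _ _ _ H) as HI.
  evar_last.
  - apply (is_derive_plus (V := R_NormedModule)).
    + apply (is_derive_mult (K := R_AbsRing)); [exact HR|exact HR|exact Rmult_comm].
    + apply (is_derive_mult (K := R_AbsRing)); [exact HI|exact HI|exact Rmult_comm].
  - unfold plus, mult, Cnorm2, Re, Im; simpl. ring.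
Qed.

Lemma is_derive_nonneg_incr (f df : R -> R) (a b : R) :
  a <= b -> (forall x, a <= x <= b -> is_derive f x (df x)) ->
  (forall x, a <= x <= b -> 0 <= df x) -> f a <= f b.
Proof.
  intros Hab Hf Hdf. destruct (Rle_lt_or_eq_dec _ _ Hab) as [Hlt|<-]; [|lra].
  destruct (MVT_cor2 f df a b Hlt) as [c [Hc1 Hc2]].
  - intros c Hc. apply is_derive_Reals, Hf, Hc.
  - specialize (Hdf c ltac:(lra)). assert (0 <= df c * (b - a)) by (apply Rmult_le_pos; lra). lra.
Qed.

(* With [Phi = y W A - W y'], an integrating factor turns the differential inequality
   for [A - y'/y] into [Phi' = y W (A' + A^2 + q) >= 0], and [Phi] vanishes at [0]. *)
Lemma riccati_comparison (q y dy A A1 W : R -> R) (l : R) :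
  filterlim y (at_right 0) (locally 0) -> filterlim dy (at_right 0) (locally 1) ->
  (forall x, 0 < x < 1 -> is_derive y x (dy x)) ->
  (forall x, 0 < x < 1 -> is_derive dy x (- q x * y x)) ->
  (forall x, 0 < x < 1 -> 0 < y x) ->
  (forall x, 0 < x < 1 -> 0 < W x) ->
  (forall x, 0 < x < 1 -> is_derive W x (A x * W x)) ->
  (forall x, 0 < x < 1 -> is_derive A x (A1 x)) ->
  (forall x, 0 < x < 1 -> - (A x * A x) - q x <= A1 x) ->
  filterlim W (at_right 0) (locally 0) ->
  filterlim (fun x => W x * A x) (at_right 0) (locally l) ->
  forall x, 0 < x < 1 -> dy x / y x <= A x.
Proof.
  intros Ly Ldy Dy Ddy Py PW DW DA HA LW LWA x Hx.
  set (Phi := fun x => y x * (W x * A x) - W x * dy x).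
  assert (LPhi : filterlim Phi (at_right 0) (locally 0)).
  { replace 0 with (0 * l - 0 * 1) at 2 by ring.
    assert (L1 : filterlim (fun x => y x * (W x * A x)) (at_right 0) (locally (0 * l))).
    { eapply (filterlim_comp_2 _ _ Rmult); [exact Ly|exact LWA|]. apply (filterlim_mult (K := R_AbsRing)). }
    assert (L2 : filterlim (fun x => - (W x * dy x)) (at_right 0) (locally (- (0 * 1)))).
    { eapply filterlim_comp; [|apply (filterlim_opp (V := R_NormedModule))].
      eapply (filterlim_comp_2 _ _ Rmult); [exact LW|exact Ldy|]. apply (filterlim_mult (K := R_AbsRing)). }
    eapply (filterlim_comp_2 _ _ Rplus); [exact L1|exact L2|].
    apply (filterlim_plus (V := R_NormedModule)). }
  assert (HPhi : 0 <= Phi x).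
  { apply Rnot_lt_le. intros Hneg.
    (* A negative value at x contradicts monotonicity: the limit 0 provides a point s < x with Phi s
       > Phi x. *)
    assert (Hpos : 0 < - Phi x) by lra.
    pose proof (proj1 (filterlim_locally _ _) LPhi (mkposreal _ Hpos)) as [d Hd].
    set (s := Rmin (d / 2) (x / 2)).
    assert (Hs : 0 < s) by (apply Rmin_pos; [pose proof (cond_pos d)|]; lra).
    pose proof (Rmin_l (d / 2) (x / 2)) as S1. pose proof (Rmin_r (d / 2) (x / 2)) as S2.
    fold s in S1, S2. pose proof (cond_pos d).
    specialize (Hd s). assert (Hb : Rabs (Phi s - 0) < - Phi x).
    { apply Hd; [|exact Hs]. change (Rabs (s - 0) < d). rewrite Rabs_pos_eq; lra. }
    rewrite Rminus_0_r in Hb. apply Rabs_def2 in Hb.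
    assert (Phi s <= Phi x); [|lra].
    apply (is_derive_nonneg_incr Phi (fun x => y x * W x * (A1 x + A x * A x + q x))); [lra| |].
    - intros t Ht. assert (Ht' : 0 < t < 1) by lra.
      specialize (Dy t Ht'). specialize (Ddy t Ht'). specialize (DW t Ht'). specialize (DA t Ht').
      unfold Phi.
      evar_last.
      + apply (is_derive_minus (V := R_NormedModule)).
        * apply (is_derive_mult (K := R_AbsRing)); [exact Dy| |exact Rmult_comm].
          apply (is_derive_mult (K := R_AbsRing)); [exact DW|exact DA|exact Rmult_comm].
        * apply (is_derive_mult (K := R_AbsRing)); [exact DW|exact Ddy|exact Rmult_comm].
      + unfold minus, plus, opp, mult; simpl. ring.
    - intros t Ht. assert (Ht' : 0 < t < 1) by lra.
      specialize (Py t Ht'). specialize (PW t Ht'). specialize (HA t Ht').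
      apply Rmult_le_pos; [apply Rmult_le_pos; lra|lra]. }
  specialize (Py x Hx). specialize (PW x Hx).
  apply Rle_div_l; [lra|]. apply Rmult_le_reg_l with (W x); [assumption|].
  unfold Phi in HPhi. lra.
Qed.

Lemma class_P_log_derivative_ge (gamma : R) (q y dy : R -> R) (L : Rbar) :
  (forall x, 0 < x < 1 -> 0 <= q x) ->
  (forall x, 0 < x < 1 -> is_derive y x (dy x)) ->
  (forall x, 0 < x < 1 -> is_derive dy x (- q x * y x)) ->
  (forall x, 0 < x < 1 -> 0 < y x) ->
  filterlim (fun x => dy x / y x) (at_left 1) (Rbar_locally L) ->
  Rbar_le gamma L ->
  forall x, 0 < x < 1 -> gamma <= dy x / y x.
Proof.
  intros Hq Dy Ddy Py HL Hg x Hx.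
  assert (Hdec : forall t, x <= t < 1 -> dy t / y t <= dy x / y x).
  { intros t Ht. apply Ropp_le_cancel.
    apply (is_derive_nonneg_incr (fun x => - (dy x / y x))
      (fun x => (dy x / y x) * (dy x / y x) + q x)); [lra| |].
    - intros s Hs. assert (Hs' : 0 < s < 1) by lra.
      specialize (Dy s Hs'). specialize (Ddy s Hs'). specialize (Py s Hs').
      evar_last.
      + apply (is_derive_opp (V := R_NormedModule)). apply is_derive_div; [exact Ddy|exact Dy|lra].
      + unfold opp; simpl. field. lra.
    - intros s Hs. specialize (Hq s ltac:(lra)).
      pose proof (Rle_0_sqr (dy s / y s)). unfold Rsqr in *. lra. }
  assert (Rbar_le L (dy x / y x)).
  { apply (filterlim_le (F := at_left 1) (fun x => dy x / y x) (fun _ => dy x / y x)).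
    - assert (Hd : 0 < 1 - x) by lra. exists (mkposreal _ Hd). intros t Ht Ht1.
      apply Hdec. change (Rabs (t - 1) < 1 - x) in Ht. apply Rabs_def2 in Ht. lra.
    - exact HL.
    - apply filterlim_const. }
  exact (Rbar_le_trans _ _ _ Hg H).
Qed.

(** * The Schwarzian criterion *)

(* [g = z^2 f'] removes the pole of [f']. *)
Lemma class_B_derive (f : C -> C) : class_B f ->
  exists g g1 g2 g3 : C -> C,
    g 0%C <> 0%C /\
    (forall z, Cmod z < 1 -> is_C_derive g z (g1 z)) /\
    (forall z, Cmod z < 1 -> is_C_derive g1 z (g2 z)) /\
    (forall z, Cmod z < 1 -> is_C_derive g2 z (g3 z)) /\
    (forall z, punctured_disk z -> Cderive f z = (g z / (z * z))%C).
Proof.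
  intros [a Ha].
  assert (HR0 : Rbar_le 1 (C_CV_radius a)).
  { apply C_CV_radius_of_convergence. intros z Hz. eexists.
    exact (proj1 (is_pseries_C_iff _ _ _) (Ha z Hz)). }
  set (a1 := CPS_derive a). set (a2 := CPS_derive a1).
  set (a3 := CPS_derive a2). set (a4 := CPS_derive a3).
  assert (HR1 : Rbar_le 1 (C_CV_radius a1)) by (unfold a1; now rewrite C_CV_radius_derive).
  assert (HR2 : Rbar_le 1 (C_CV_radius a2)) by (unfold a2; now rewrite C_CV_radius_derive).
  assert (HR3 : Rbar_le 1 (C_CV_radius a3)) by (unfold a3; now rewrite C_CV_radius_derive).
  pose proof (fun z => is_C_derive_CPS a z HR0) as D0.
  pose proof (fun z => is_C_derive_CPS a1 z HR1) as D1.
  pose proof (fun z => is_C_derive_CPS a2 z HR2) as D2.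
  pose proof (fun z => is_C_derive_CPS a3 z HR3) as D3.
  fold a1 in D0. fold a2 in D1. fold a3 in D2. fold a4 in D3.
  assert (Dsq : forall z : C, is_C_derive (fun w => w * w)%C z (2 * z)%C).
  { intros z. replace (2 * z)%C with (1 * z + z * 1)%C by ring.
    apply (is_C_derive_mult (fun w => w) (fun w => w)); apply is_C_derive_id. }
  assert (Dlin : forall k z : C, is_C_derive (fun w => k * w)%C z k).
  { intros k z. evar_last.
    - apply (is_C_derive_mult (fun _ => k) (fun w => w)); [apply is_C_derive_const|apply is_C_derive_id].
    - C_eq. ring. }
  (* Differentiating f = 1/z + [CPS a] and multiplying by z^2 gives this [g], with value -1 at 0.
     Three derivatives are supplied because the maximum principle for z g'/g differentiates it
     twice. *)
  exists (fun z => z * z * CPS a1 z - 1)%C.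
  exists (fun z => 2 * z * CPS a1 z + z * z * CPS a2 z)%C.
  exists (fun z => 2 * CPS a1 z + 4 * z * CPS a2 z + z * z * CPS a3 z)%C.
  exists (fun z => 6 * CPS a2 z + 6 * z * CPS a3 z + z * z * CPS a4 z)%C.
  repeat apply conj.
  - replace (0 * 0 * CPS a1 0 - 1)%C with (RtoC (-1)).
    + intros E. apply RtoC_inj in E. lra.
    + apply injective_projections; simpl; ring.
  - intros z Hz. specialize (D1 z Hz).
    replace (2 * z * CPS a1 z + z * z * CPS a2 z)%C
      with ((2 * z * CPS a1 z + z * z * CPS a2 z) - 0)%C by ring.
    apply (is_C_derive_minus (fun z => z * z * CPS a1 z)%C (fun _ => 1%C)); [|apply is_C_derive_const].
    apply (is_C_derive_mult (fun z => z * z)%C (CPS a1)); [apply Dsq|exact D1].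
  - intros z Hz. specialize (D1 z Hz). specialize (D2 z Hz).
    replace (2 * CPS a1 z + 4 * z * CPS a2 z + z * z * CPS a3 z)%C
      with ((2 * CPS a1 z + 2 * z * CPS a2 z) + (2 * z * CPS a2 z + z * z * CPS a3 z))%C by ring.
    apply (is_C_derive_plus (fun z => 2 * z * CPS a1 z)%C (fun z => z * z * CPS a2 z)%C).
    + apply (is_C_derive_mult (fun z => 2 * z)%C (CPS a1)); [apply Dlin|exact D1].
    + apply (is_C_derive_mult (fun z => z * z)%C (CPS a2)); [apply Dsq|exact D2].
  - intros z Hz. specialize (D1 z Hz). specialize (D2 z Hz). specialize (D3 z Hz).
    replace (6 * CPS a2 z + 6 * z * CPS a3 z + z * z * CPS a4 z)%C
      with ((0 * CPS a1 z + 2 * CPS a2 z) + (4 * CPS a2 z + 4 * z * CPS a3 z)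
            + (2 * z * CPS a3 z + z * z * CPS a4 z))%C by ring.
    apply (is_C_derive_plus (fun z => 2 * CPS a1 z + 4 * z * CPS a2 z)%C (fun z => z * z * CPS a3 z)%C).
    + apply (is_C_derive_plus (fun z => 2 * CPS a1 z)%C (fun z => 4 * z * CPS a2 z)%C).
      * apply (is_C_derive_mult (fun _ => 2%C) (CPS a1)); [apply is_C_derive_const|exact D1].
      * apply (is_C_derive_mult (fun z => 4 * z)%C (CPS a2)); [apply Dlin|exact D2].
    + apply (is_C_derive_mult (fun z => z * z)%C (CPS a3)); [apply Dsq|exact D3].
  - intros z Hz. apply Cderive_unique.
    apply (is_C_derive_ext_punctured (fun z => / z + CPS a z)%C); [|assumption|].
    + intros w Hw. unfold CPS. rewrite (CSeries_unique _ (f w - / w)%C).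
      * ring.
      * exact (proj1 (is_pseries_C_iff _ _ _) (Ha w Hw)).
    + destruct Hz as [Hz0 Hz1].
      replace ((z * z * CPS a1 z - 1) / (z * z))%C with (- (1) / (z * z) + CPS a1 z)%C
        by (field; assumption).
      apply (is_C_derive_plus (fun z => / z)%C (CPS a)); [|now apply D0].
      apply (is_C_derive_inv (fun z => z)); [apply is_C_derive_id|assumption].
Qed.

(** Logarithmic differentiation of f' = g/z^2. In the Schwarzian the two contributions 2/z^2 cancel,
    so only a 1/z term remains. *)
Lemma schwarzian_of_derive (f g g1 g2 : C -> C) :
  (forall z, Cmod z < 1 -> g z <> 0%C) ->
  (forall z, Cmod z < 1 -> is_C_derive g z (g1 z)) ->
  (forall z, Cmod z < 1 -> is_C_derive g1 z (g2 z)) ->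
  (forall z, punctured_disk z -> Cderive f z = (g z / (z * z))%C) ->
  forall z, punctured_disk z ->
    pre_schwarzian f z = (g1 z / g z - 2 / z)%C /\
    schwarzian f z = ((g2 z / g z - g1 z / g z * (g1 z / g z))
       + 2 * (g1 z / g z) / z - / 2 * (g1 z / g z * (g1 z / g z)))%C.
Proof.
  intros Hg Dg Dg1 Hf.
  assert (Hpre : forall z, punctured_disk z -> pre_schwarzian f z = (g1 z / g z - 2 / z)%C).
  { intros z Hz. unfold pre_schwarzian.
    assert (E : Cderive (Cderive f) z = (g1 z / (z * z) - 2 * g z / (z * z * z))%C).
    { apply Cderive_unique.
      apply (is_C_derive_ext_punctured (fun z => g z / (z * z))%C);
        [intros w Hw; symmetry; now apply Hf|assumption|].
      destruct Hz as [Hz0 Hz1].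
      replace (g1 z / (z * z) - 2 * g z / (z * z * z))%C
        with (g1 z / (z * z) - g z / (z * z) * ((1 * z + z * 1) / (z * z)))%C by (field; assumption).
      apply (is_C_derive_div g (fun z => z * z)%C); [now apply Dg| |now apply Cmult_neq_0].
      apply (is_C_derive_mult (fun w => w) (fun w => w)); apply is_C_derive_id. }
    rewrite E, (Hf z Hz). destruct Hz as [Hz0 Hz1]. specialize (Hg z Hz1). field. now split. }
  intros z Hz. split; [now apply Hpre|].
  unfold schwarzian.
  assert (E : Cderive (pre_schwarzian f) z
    = ((g2 z / g z - g1 z / g z * (g1 z / g z)) + 2 / (z * z))%C).
  { apply Cderive_unique.
    apply (is_C_derive_ext_punctured (fun z => g1 z / g z - 2 / z)%C);
      [intros w Hw; symmetry; now apply Hpre|assumption|].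
    destruct Hz as [Hz0 Hz1].
    replace ((g2 z / g z - g1 z / g z * (g1 z / g z)) + 2 / (z * z))%C
      with ((g2 z / g z - g1 z / g z * (g1 z / g z)) - (0 / z - 2 / z * (1 / z)))%C.
    2:{ specialize (Hg z Hz1). field. now split. }
    apply (is_C_derive_minus (fun z => g1 z / g z)%C (fun z => 2 / z)%C).
    - apply is_C_derive_div; auto.
    - apply (is_C_derive_div (fun _ => 2%C) (fun z => z));
        [apply is_C_derive_const|apply is_C_derive_id|assumption]. }
  rewrite E, (Hpre z Hz). destruct Hz as [Hz0 Hz1]. specialize (Hg z Hz1). 
  assert (H2 : RtoC 2 <> 0%C) by (intros E2; apply RtoC_inj in E2; lra).
  field. repeat split; assumption.
Qed.

Lemma ray_comparison (q y dy : R -> R) (g g1 g2 : C -> C) :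
  (forall z, Cmod z < 1 -> g z <> 0%C) ->
  (forall z, Cmod z < 1 -> is_C_derive g z (g1 z)) ->
  (forall z, Cmod z < 1 -> is_C_derive g1 z (g2 z)) ->
  (forall z, punctured_disk z ->
     Cmod ((g2 z / g z - g1 z / g z * (g1 z / g z))
       + 2 * (g1 z / g z) / z - / 2 * (g1 z / g z * (g1 z / g z))) <= 2 * q (Cmod z)) ->
  filterlim y (at_right 0) (locally 0) -> filterlim dy (at_right 0) (locally 1) ->
  (forall x, 0 < x < 1 -> is_derive y x (dy x)) ->
  (forall x, 0 < x < 1 -> is_derive dy x (- q x * y x)) ->
  (forall x, 0 < x < 1 -> 0 < y x) ->
  forall (c : C) (r : R), Cmod c = 1 -> 0 < r < 1 ->
    dy r / y r <= / r - Re (c * (g1 (r * c)%C / g (r * c)%C)) / 2.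
Proof.
  intros Hg Dg Dg1 HS Ly Ldy Dy Ddy Py c r Hc Hr.
  set (h := fun z => (g1 z / g z)%C).
  set (h1 := fun z => (g2 z / g z - h z * h z)%C).
  assert (Hmod : forall x : R, Rabs x < 1 -> Cmod (x * c) < 1).
  { intros x Hx. rewrite Cmod_mult, Hc, Cmod_R. lra. }
  assert (Dh : forall z, Cmod z < 1 -> is_C_derive h z (h1 z)).
  { intros z Hz. apply is_C_derive_div; auto. }
  set (N := fun s : R => Cnorm2 (g (s * c)%C)).
  assert (PN : forall x, Rabs x < 1 -> 0 < N x) by (intros x Hx; apply Cnorm2_pos, Hg, Hmod, Hx).
  set (k := fun s : R => Re (c * h (s * c)%C)).
  assert (DN : forall x, Rabs x < 1 -> is_derive N x (2 * k x * N x)).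
  { intros x Hx. apply is_derive_Cnorm2_ray. unfold h.
    pose proof (Hg _ (Hmod x Hx)) as Hn.
    replace (g1 (x * c)%C / g (x * c)%C * g (x * c)%C)%C with (g1 (x * c)%C) by (field; assumption).
    apply Dg, Hmod, Hx. }
  assert (Dk : forall x, Rabs x < 1 -> is_derive k x (Re (c * (c * h1 (x * c)%C)))).
  { intros x Hx.
    apply (is_derive_ext (fun s : R => Re (c * h (0 + s * c)%C))).
    - intros s. unfold k. now rewrite Cplus_0_l.
    - apply is_derive_Re_line. rewrite Cplus_0_l. apply Dh, Hmod, Hx. }
  (* [V] is |g|^(-1/2), so s V(s) = |f'|^(-1/2) on the ray: the modulus of the classical solution
     1/sqrt(f') of u'' + (S_f/2) u = 0. It is the integrating factor for A and vanishes at 0. *)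
  set (V := fun s => exp (- / 4 * ln (N s))).
  assert (DV : forall x, Rabs x < 1 -> is_derive V x (- k x / 2 * V x)).
  { intros x Hx. specialize (DN x Hx). specialize (PN x Hx). unfold V.
    evar_last.
    - apply (is_derive_comp exp (fun s => - / 4 * ln (N s))).
      + apply is_derive_exp.
      + apply is_derive_scal. apply (is_derive_comp ln N); [apply is_derive_ln; exact PN|exact DN].
    - unfold scal; simpl. unfold mult; simpl. field. lra. }
  assert (L0 : forall F : R -> R, continuous F 0 -> filterlim F (at_right 0) (locally (F 0))).
  { intros F HF P HP. destruct (HF P HP) as [e He]. exists e. intros t Ht _. now apply He. }
  assert (Habs : forall x, 0 < x < 1 -> Rabs x < 1) by (intros x Hx; rewrite Rabs_pos_eq; lra).
  assert (H0 : Rabs 0 < 1) by (rewrite Rabs_R0; lra).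
  assert (CV : continuous V 0) by (apply (ex_derive_continuous (V := R_NormedModule)); eexists; apply DV, H0).
  assert (Ck : continuous k 0) by (apply (ex_derive_continuous (V := R_NormedModule)); eexists; apply Dk, H0).
  apply (riccati_comparison q y dy (fun s => / s - k s / 2)
    (fun s => - / (s * s) - Re (c * (c * h1 (s * c)%C)) / 2) (fun s => s * V s) (V 0)); try assumption.
  - intros x Hx. apply Rmult_lt_0_compat; [lra|apply exp_pos].
  - intros x Hx. specialize (DV x (Habs x Hx)).
    evar_last.
    + apply (is_derive_mult (K := R_AbsRing)); [apply (is_derive_id (K := R_AbsRing))|exact DV|exact Rmult_comm].
    + unfold plus, mult, one; simpl. field. lra.
  - intros x Hx. specialize (Dk x (Habs x Hx)).
    set (D := Re (c * (c * h1 (x * c)%C))) in *. clearbody D.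
    evar_last.
    + apply (is_derive_minus (V := R_NormedModule)).
      * apply is_derive_inv; [apply (is_derive_id (K := R_AbsRing))|lra].
      * apply (is_derive_ext (fun s => / 2 * k s)); [intros s; unfold Rdiv; simpl; ring|].
        apply is_derive_scal. exact Dk.
    + unfold minus, plus, opp, one; simpl. field. lra.
  - intros x Hx. pose proof (Hmod x (Habs x Hx)) as Hm.
    assert (Hxc : Cmod (x * c) = x) by (rewrite Cmod_mult, Hc, Cmod_R, Rabs_pos_eq; lra).
    assert (Hp : punctured_disk (x * c)%C) by (split; [apply Cmod_gt_0|]; lra).
    specialize (HS _ Hp). rewrite Hxc in HS. fold (h (x * c)%C) in HS. fold (h1 (x * c)%C) in HS.
    set (H := h (x * c)%C) in *. set (H1 := h1 (x * c)%C) in *.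
    set (S := (H1 + 2 * H / (x * c) - / 2 * (H * H))%C) in *.
    assert (Hx0 : RtoC x <> 0%C) by (intros E; apply RtoC_inj in E; lra).
    assert (Hc0 : c <> 0%C) by (apply Cmod_gt_0; lra).
    assert (H2 : RtoC 2 <> 0%C) by (intros E; apply RtoC_inj in E; lra).
    assert (HSc : Re (c * c * S) <= 2 * q x).
    { eapply Rle_trans; [apply Re_le_Cmod|]. rewrite !Cmod_mult, Hc. lra. }
    assert (ES : (c * c * S)%C = (c * (c * H1) + RtoC (2 / x) * (c * H) - RtoC (/ 2) * ((c * H) * (c * H)))%C).
    { unfold S. rewrite RtoC_div, RtoC_inv by lra. field. repeat split; assumption. }
    rewrite ES in HSc. unfold k. fold H.
    set (X := (c * H)%C) in *. set (Z := (c * (c * H1))%C) in *.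
    assert (ER : Re (Z + RtoC (2 / x) * X - RtoC (/ 2) * (X * X))
       = Re Z + 2 / x * Re X - / 2 * (Re X * Re X - Im X * Im X)).
    { unfold Re, Im; simpl. ring. }
    rewrite ER in HSc.
    (* The square of Im (c h) enters A' with a favourable sign; dropping it turns the complex
       Riccati equation into the inequality for its real part. *)
    pose proof (Rle_0_sqr (Im X)) as HI. unfold Rsqr in HI.
    replace (- ((/ x - Re X / 2) * (/ x - Re X / 2)) - q x)
      with (- / (x * x) + / x * Re X - / 4 * (Re X * Re X) - q x) by (field; lra).
    replace (2 / x * Re X) with (2 * (/ x * Re X)) in HSc by (field; lra).
    lra.
  - replace 0 with (0 * V 0) at 2 by ring. apply (L0 (fun s => s * V s)).
    apply (continuous_mult (K := R_AbsRing)); [apply continuous_id|exact CV].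
  (* In W A the factor s cancels the pole 1/s of A, which leaves an expression continuous at 0. *)
  - apply (filterlim_ext_loc (fun s => V s * (1 - s * (k s / 2)))).
    + exists (mkposreal 1 Rlt_0_1). intros s _ Hs. simpl. field. lra.
    + replace (V 0) with (V 0 * (1 - 0 * (k 0 / 2))) by ring.
      apply (L0 (fun s => V s * (1 - s * (k s / 2)))).
      apply (continuous_mult (K := R_AbsRing)); [exact CV|].
      apply (continuous_minus (V := R_NormedModule)); [apply continuous_const|].
      apply (continuous_mult (K := R_AbsRing)); [apply continuous_id|].
      apply (continuous_mult (K := R_AbsRing)); [exact Ck|apply continuous_const].
Qed.

Lemma schwarzian_criterion (alpha : R) (q : R -> R) (f : C -> C) :
  0 <= alpha < 1 ->
  class_P ((1 + alpha) / 2) q -> class_B f -> locally_univalent f ->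
  (forall z, punctured_disk z -> Cmod (schwarzian f z) <= 2 * q (Cmod z)) ->
  class_BC alpha f.
Proof.
  intros Ha [_ [Hq [y [dy [_ [_ [Ly [Ldy [Dy [Ddy [Py [L [HL HgL]]]]]]]]]]]]] HB Hu HS.
  split; [assumption|split; [assumption|]].
  destruct (class_B_derive f HB) as [g [g1 [g2 [g3 [Hg0 [Dg [Dg1 [Dg2 Hf]]]]]]]].
  assert (Hg : forall z, Cmod z < 1 -> g z <> 0%C).
  { intros z Hz. destruct (Ceq_dec z 0%C) as [->|Hz0]; [assumption|].
    assert (Hp : punctured_disk z) by now split.
    intros E. apply (Hu z Hp). rewrite (Hf z Hp), E. field. assumption. }
  pose proof (schwarzian_of_derive f g g1 g2 Hg Dg Dg1 Hf) as HE.
  set (h := fun z => (g1 z / g z)%C).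
  set (k := fun z => (g2 z / g z)%C).
  set (h1 := fun z => (k z - h z * h z)%C).
  set (k1 := fun z => (g3 z / g z - k z * h z)%C).
  assert (Dh : forall z, Cmod z < 1 -> is_C_derive h z (h1 z)).
  { intros z Hz. apply is_C_derive_div; auto. }
  assert (Dk : forall z, Cmod z < 1 -> is_C_derive k z (k1 z)).
  { intros z Hz. apply is_C_derive_div; auto. }
  assert (Dh1 : forall z, Cmod z < 1 -> is_C_derive h1 z (k1 z - (h1 z * h z + h z * h1 z))%C).
  { intros z Hz. apply (is_C_derive_minus k (fun z => h z * h z)%C); [now apply Dk|].
    apply is_C_derive_mult; now apply Dh. }
  pose proof (class_P_log_derivative_ge _ q y dy L (fun x Hx => Hq x ltac:(lra)) Dy Ddy Py HL HgL) as HY.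
  set (gamma := (1 + alpha) / 2) in *.
  (* The ray estimate proves this on |z| = r, and the maximum principle transfers it inside. For
     fixed z the radius r remains free and can be pushed towards 1. *)
  assert (Hbd : forall r z, 0 < r < 1 -> Cmod z <= r -> Re (z * h z) <= 2 - 2 * r * gamma).
  { intros r z Hr Hz.
    apply (Re_maximum_principle (fun z => z * h z)%C (fun z => 1 * h z + z * h1 z)%C
      (fun z => (h1 z) + (1 * h1 z + z * (k1 z - (h1 z * h z + h z * h1 z))))%C r); auto.
    - intros w Hw. apply (is_C_derive_mult (fun z => z) h); [apply is_C_derive_id|now apply Dh].
    - intros w Hw. apply (is_C_derive_plus (fun z => 1 * h z)%C (fun z => z * h1 z)%C).
      + replace (h1 w) with (0 * h w + 1 * h1 w)%C by ring.
        apply (is_C_derive_mult (fun _ => 1%C) h); [apply is_C_derive_const|now apply Dh].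
      + apply (is_C_derive_mult (fun z => z) h1); [apply is_C_derive_id|now apply Dh1].
    - intros w Hw. set (c := (w / RtoC r)%C).
      assert (Hr0 : RtoC r <> 0%C) by (intros E; apply RtoC_inj in E; lra).
      assert (Hc : Cmod c = 1).
      { unfold c. rewrite Cmod_div, Hw, Cmod_R, Rabs_pos_eq by (assumption || lra). field. lra. }
      assert (Hwc : w = (r * c)%C) by (unfold c; field; assumption).
      pose proof (ray_comparison q y dy g g1 g2 Hg Dg Dg1) as HC.
      specialize (HC ltac:(intros v Hv; rewrite <- (proj2 (HE v Hv)); now apply HS)
        Ly Ldy Dy Ddy Py c r Hc Hr).
      rewrite <- Hwc in HC. fold (h w) in HC.
      pose proof (Rle_trans _ _ _ (HY r Hr) HC) as HD.
      apply (Rmult_le_compat_l r) in HD; [|lra].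
      replace (r * (/ r - Re (c * h w) / 2)) with (1 - r * Re (c * h w) / 2) in HD by (field; lra).
      replace (Re (w * h w)) with (r * Re (c * h w)); [lra|].
      rewrite Hwc at 2. unfold Re; simpl. ring. }
  intros z Hz. pose proof (proj1 (HE z Hz)) as Epre. unfold pre_schwarzian in Epre.
  rewrite Epre. fold (h z). destruct Hz as [Hz0 Hz1].
  replace (1 + z * (h z - 2 / z))%C with (z * h z - 1)%C by (field; assumption).
  replace (Re (z * h z - 1)) with (Re (z * h z) - 1) by reflexivity.
  apply Rnot_lt_le. intros Hlt.
  set (d := Re (z * h z) - 1 + alpha).
  (* The first entry keeps |z| <= 1 - e. At radius 1 - e the bound exceeds its limit by 2 e gamma <=
     2 e <= d/2, less than the assumed excess d. *)
  set (e := Rmin ((1 - Cmod z) / 2) (d / 4)).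
  assert (He : 0 < e) by (apply Rmin_pos; unfold d; lra).
  pose proof (Rmin_l ((1 - Cmod z) / 2) (d / 4)) as E1. fold e in E1.
  pose proof (Rmin_r ((1 - Cmod z) / 2) (d / 4)) as E2. fold e in E2.
  pose proof (Cmod_ge_0 z).
  specialize (Hbd (1 - e) z ltac:(lra) ltac:(lra)).
  assert (2 * e * gamma <= 2 * e).
  { assert (gamma <= 1) by (unfold gamma; lra). nra. }
  unfold d in E2. unfold gamma in *. lra.
Qed.

(** * Laurent coefficients of the cotangent *)

(* [cot_table k n] agrees with the coefficient sequence on indices [<= n]. *)
Fixpoint cot_table (k : R) (n : nat) : nat -> R :=
  match n with
  | O => fun _ => 0
  | S m => fun i => if (i <=? m)%nat then cot_table k m i
      else ((if (m =? 0)%nat then k * k else 0)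
             + PS_mult (cot_table k m) (cot_table k m) m) / (INR m + 3)
  end.

(* Coefficients of [1/z - k cot(kz)]. *)
Definition cot_coef (k : R) (n : nat) : R := cot_table k n n.

Lemma cot_table_stable (k : R) (n i : nat) : (i <= n)%nat -> cot_table k n i = cot_coef k i.
Proof.
  induction n as [|n IH]; intros Hi.
  - now replace i with O by lia.
  - destruct (Nat.eq_dec i (S n)) as [->|Hne]; [reflexivity|].
    simpl. replace (i <=? n)%nat with true by (symmetry; apply Nat.leb_le; lia).
    apply IH. lia.
Qed.

Lemma cot_coef_0 (k : R) : cot_coef k 0 = 0.
Proof. reflexivity. Qed.

(** With delta = 1/z - f, the Riccati equation reads z delta' + 2 delta = k^2 z + z delta^2, and
    this is its coefficient of z^(n+1). The factor n + 3 adds n + 1 from differentiation and 2 from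
    the pole. *)
Lemma cot_coef_S (k : R) (n : nat) :
  (INR n + 3) * cot_coef k (S n)
  = (if (n =? 0)%nat then k * k else 0) + PS_mult (cot_coef k) (cot_coef k) n.
Proof.
  assert (E : PS_mult (cot_table k n) (cot_table k n) n = PS_mult (cot_coef k) (cot_coef k) n).
  { apply sum_eq. intros i Hi. rewrite !cot_table_stable by lia. reflexivity. }
  rewrite <- E. unfold cot_coef.
  change (cot_table k (S n) (S n)) with (if (S n <=? n)%nat then cot_table k n (S n)
    else ((if (n =? 0)%nat then k * k else 0)
           + PS_mult (cot_table k n) (cot_table k n) n) / (INR n + 3)).
  replace (S n <=? n)%nat with false by (symmetry; apply Nat.leb_gt; lia).
  field. pose proof (pos_INR n). lra.
Qed.

(* The first nonzero coefficient is [k^2/3 = rho^2]; afterwards the [n + 1] products in the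
   recursion are absorbed by the divisor [n + 3]. *)
Lemma cot_coef_bound (k rho : R) : 0 <= rho -> k * k = 3 * (rho * rho) ->
  forall n, 0 <= cot_coef k n <= rho ^ S n.
Proof.
  intros Hr Hk n. induction n as [n IH] using (well_founded_induction Wf_nat.lt_wf).
  destruct n as [|n].
  - rewrite cot_coef_0. simpl. lra.
  - pose proof (cot_coef_S k n) as E. pose proof (pos_INR n) as Hn.
    assert (HP : 0 <= PS_mult (cot_coef k) (cot_coef k) n <= (INR n + 1) * rho ^ S (S n)).
    { unfold PS_mult. split.
      - apply cond_pos_sum. intros i.
        destruct (Compare_dec.le_lt_dec i n) as [Hi|Hi].
        + apply Rmult_le_pos; apply IH; lia.
        (* [cond_pos_sum] asks for every i; beyond n the truncated difference is 0, where the
           coefficient vanishes. *)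
        + replace (n - i)%nat with O by lia. rewrite cot_coef_0. lra.
      - replace ((INR n + 1) * rho ^ S (S n)) with (sum_f_R0 (fun _ => rho ^ S (S n)) n).
        2:{ rewrite sum_cte, S_INR. ring. }
        apply sum_Rle. intros i Hi.
        replace (rho ^ S (S n)) with (rho ^ S i * rho ^ S (n - i)).
        2:{ rewrite <- pow_add. f_equal. lia. }
        apply Rmult_le_compat; apply IH; lia. }
    destruct n as [|n].
    + unfold PS_mult in E. simpl in E. rewrite cot_coef_0 in E. simpl. nra.
    + simpl Nat.eqb in E. cbv iota in E. rewrite Rplus_0_l in E.
      set (m := INR (S n)) in *. set (x := cot_coef k (S (S n))) in *.
      set (t := rho ^ S (S (S n))) in *. assert (0 <= t) by now apply pow_le.
      split; apply Rmult_le_reg_l with (m + 3); nra.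
Qed.

Definition cot_delta (k : R) : C -> C := CPS (fun n => RtoC (cot_coef k n)).

Definition cot_delta1 (k : R) : C -> C := CPS (CPS_derive (fun n => RtoC (cot_coef k n))).

Lemma cot_radius (k rho : R) : 0 <= rho < 1 -> k * k = 3 * (rho * rho) ->
  Rbar_le 1 (C_CV_radius (fun n => RtoC (cot_coef k n))).
Proof.
  intros Hrho Hk. apply C_CV_radius_ge_1. intros r Hr. exists 1. intros n.
  pose proof (cot_coef_bound k rho ltac:(lra) Hk n) as B.
  rewrite Cmod_R, Rabs_pos_eq by apply B.
  assert (rho ^ S n <= 1) by (rewrite <- (pow1 (S n)); apply pow_incr; lra).
  assert (0 <= r ^ n <= 1) by (split; [apply pow_le; lra|rewrite <- (pow1 n); apply pow_incr; lra]).
  nra.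
Qed.

(** A geometric majorant. The bound is uniform on the disk and supplies the growth rate in the
    exponential estimates for linear equations with coefficient delta. *)
Lemma cot_delta_bound (k rho : R) : 0 <= rho < 1 -> k * k = 3 * (rho * rho) ->
  forall z, Cmod z < 1 -> Cmod (cot_delta k z) <= rho / (1 - rho).
Proof.
  intros Hrho Hk z Hz.
  apply (is_C_series_Cmod_le (fun n => RtoC (cot_coef k n) * z ^ n)%C (fun n => rho * rho ^ n)).
  - intros n. rewrite Cmod_mult, Cmod_pow, Cmod_R.
    pose proof (cot_coef_bound k rho ltac:(lra) Hk n) as B.
    rewrite Rabs_pos_eq by apply B. change (rho ^ S n) with (rho * rho ^ n) in B.
    pose proof (Cmod_ge_0 z).
    assert (0 <= Cmod z ^ n <= 1)
      by (split; [apply pow_le; lra|rewrite <- (pow1 n); apply pow_incr; lra]).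
    nra.
  - apply CPS_correct; [now apply (cot_radius k rho)|assumption].
  - unfold Rdiv. apply (is_series_scal (V := R_NormedModule) rho (fun n => rho ^ n) (/ (1 - rho))).
    apply is_series_geom. rewrite Rabs_pos_eq; lra.
Qed.

Lemma sum_n_Cauchy_monomial (u v : nat -> R) (z : C) (n : nat) :
  @sum_n C_AbelianMonoid (fun i => RtoC (u i) * z ^ i * (RtoC (v (n - i)%nat) * z ^ (n - i)))%C n
  = (RtoC (PS_mult u v n) * z ^ n)%C.
Proof.
  assert (E : forall m w, @sum_n C_AbelianMonoid (fun i => RtoC (w i) * z ^ n)%C m
    = (RtoC (sum_f_R0 w m) * z ^ n)%C).
  { intros m w. induction m as [|m IH]; [now rewrite sum_O|].
    rewrite sum_Sn, IH. simpl sum_f_R0. rewrite RtoC_plus.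
    change (@plus ?G ?a ?b) with (a + b)%C. C_eq. ring. }
  unfold PS_mult. rewrite <- E. apply sum_n_ext_loc. intros i Hi. C_eq.
  replace (z ^ n)%C with (z ^ i * z ^ (n - i))%C.
  2:{ rewrite <- Cpow_add_r. f_equal. lia. }
  rewrite RtoC_mult. ring.
Qed.

Lemma cot_delta_riccati (k rho : R) : 0 <= rho < 1 -> k * k = 3 * (rho * rho) ->
  forall z, Cmod z < 1 ->
  (z * cot_delta1 k z + 2 * cot_delta k z
   = RtoC (k * k) * z + z * (cot_delta k z * cot_delta k z))%C.
Proof.
  intros Hrho Hk z Hz. pose proof (cot_radius k rho Hrho Hk) as HR.
  pose proof (CPS_correct _ z HR Hz) as S0. fold (cot_delta k) in S0.
  assert (HR1 : Rbar_le 1 (C_CV_radius (CPS_derive (fun n => RtoC (cot_coef k n)))))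
    by now rewrite C_CV_radius_derive.
  pose proof (CPS_correct _ z HR1 Hz) as S1. fold (cot_delta1 k) in S1.
  assert (A0 : ex_series (fun n => Cmod (RtoC (cot_coef k n) * z ^ n))).
  { eapply ex_series_ext; [|apply (ex_series_CPS_abs _ (Cmod z) HR)].
    - intros n. simpl. now rewrite Cmod_mult, Cmod_pow.
    - split; [apply Cmod_ge_0|assumption]. }
  pose proof (is_C_series_mult _ _ _ _ S0 S0 A0 A0) as S2.
  apply (is_C_series_scal z) in S2. apply (is_C_series_scal z) in S1.
  (* Since the coefficient of index 0 vanishes, the series of 2 delta can be shifted, so that the
     n-th terms of all the series belong to z^(n+1). The term k^2 z then sits at n = 0. *)
  pose proof (is_C_series_scal 2%C _ _ S0) as S02. apply is_C_series_shift in S02.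
  2:{ rewrite cot_coef_0. ring. }
  pose proof (is_C_series_plus _ _ _ _ S1 S02) as SL.
  assert (Sk : is_C_series (fun n => if (n =? 0)%nat then RtoC (k * k) * z else RtoC 0)%C (RtoC (k * k) * z)%C).
  { apply (@is_series_decr_1 C_AbsRing C_NormedModule). simpl.
    (* The tail is the zero series, obtained as 0 times the convergent series of delta. *)
    match goal with |- is_series _ ?l => replace l with (0 * cot_delta k z)%C end.
    2:{ change ((0 * cot_delta k z) = RtoC (k * k) * z - RtoC (k * k) * z)%C. ring. }
    eapply is_series_ext; [|exact (is_C_series_scal 0%C _ _ S0)].
    intros n. apply Cmult_0_l. }
  pose proof (is_C_series_plus _ _ _ _ Sk S2) as SR.
  rewrite <- (CSeries_unique _ _ SL). apply CSeries_unique.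
  eapply is_series_ext; [|exact SR]. intros n. cbv beta.
  pose proof (sum_n_Cauchy_monomial (cot_coef k) (cot_coef k) z n) as EM.
  match goal with |- (?a + _ * ?s)%C = _ => change s with
    (@sum_n C_AbelianMonoid (fun i => RtoC (cot_coef k i) * z ^ i
      * (RtoC (cot_coef k (n - i)%nat) * z ^ (n - i)))%C n) end.
  rewrite EM. C_eq. unfold CPS_derive. rewrite Cpow_S.
  pose proof (f_equal RtoC (cot_coef_S k n)) as E.
  rewrite RtoC_mult, RtoC_plus, RtoC_plus in E.
  set (w := RtoC (PS_mult (cot_coef k) (cot_coef k) n)) in *.
  replace w with ((RtoC (INR n) + 3) * RtoC (cot_coef k (S n))
    - RtoC (if (n =? 0)%nat then k * k else 0))%C by (rewrite E; ring).
  rewrite S_INR, RtoC_plus.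
  destruct n; simpl; ring.
Qed.

(** * Sharpness *)

(** Gronwall's inequality: N(x) exp(-M x) is nondecreasing. It serves both to keep a solution of a
    linear equation away from 0 and, applied to minus a square norm, to keep a solution starting at
    0 equal to 0. *)
Lemma is_derive_ge_exp (N dN : R -> R) (M b : R) :
  0 <= b -> (forall x, 0 <= x <= b -> is_derive N x (dN x)) ->
  (forall x, 0 <= x <= b -> M * N x <= dN x) -> N 0 <= N b * exp (- M * b).
Proof.
  intros Hb HN HdN.
  replace (N 0) with (N 0 * exp (- M * 0)) by (rewrite Rmult_0_r, exp_0; ring).
  apply (is_derive_nonneg_incr (fun x => N x * exp (- M * x))
    (fun x => (dN x - M * N x) * exp (- M * x))); [assumption| |].
  - intros x Hx. specialize (HN x Hx).
    evar_last.
    + apply (is_derive_mult (K := R_AbsRing)); [exact HN| |exact Rmult_comm].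
      apply (is_derive_comp exp (fun x => - M * x)); [apply is_derive_exp|].
      apply is_derive_scal. apply (is_derive_id (K := R_AbsRing)).
    + unfold plus, mult, scal, one; simpl. unfold mult; simpl. ring.
  - intros x Hx. specialize (HdN x Hx). apply Rmult_le_pos; [lra|apply Rlt_le, exp_pos].
Qed.

(* [1 - z delta = z f] for [f = 1/z - delta]. *)
Lemma is_C_derive_cot_E (k rho : R) : 0 <= rho < 1 -> k * k = 3 * (rho * rho) ->
  forall z, Cmod z < 1 ->
  is_C_derive (fun z => 1 - z * cot_delta k z)%C z
    (cot_delta k z * (1 - z * cot_delta k z) - RtoC (k * k) * z)%C.
Proof.
  intros Hrho Hk z Hz.
  evar_last.
  - apply (is_C_derive_minus (fun _ => 1%C) (fun z => z * cot_delta k z)%C); [apply is_C_derive_const|].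
    apply (is_C_derive_mult (fun z => z) (cot_delta k)); [apply is_C_derive_id|].
    apply (is_C_derive_CPS _ z (cot_radius k rho Hrho Hk) Hz).
  - fold (cot_delta1 k). C_eq.
    pose proof (cot_delta_riccati k rho Hrho Hk z Hz) as E.
    replace (z * cot_delta1 k z)%C
      with (RtoC (k * k) * z + z * (cot_delta k z * cot_delta k z) - 2 * cot_delta k z)%C
      by (rewrite <- E; ring).
    ring.
Qed.

(* [z^2 f'] for [f = 1/z - delta], in a form without pole. *)
Definition cot_g (k : R) (z : C) : C :=
  (- ((1 - z * cot_delta k z) * (1 - z * cot_delta k z)) - RtoC (k * k) * (z * z))%C.

(** Differentiating f' = - k^2 - f^2 gives f''/f' = - 2 f, hence g'/g = - 2 f + 2/z = 2 delta. *)
Lemma is_C_derive_cot_g (k rho : R) : 0 <= rho < 1 -> k * k = 3 * (rho * rho) ->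
  forall z, Cmod z < 1 -> is_C_derive (cot_g k) z (2 * cot_delta k z * cot_g k z)%C.
Proof.
  intros Hrho Hk z Hz.
  pose proof (is_C_derive_cot_E k rho Hrho Hk z Hz) as DE.
  apply (is_derive_ext (V := C_NormedModule) (fun z => (0 - (1 - z * cot_delta k z) * (1 - z * cot_delta k z))
     - RtoC (k * k) * (z * z))%C).
  { intros w. C_eq. unfold cot_g. ring. }
  evar_last.
  - apply (is_C_derive_minus (fun z => 0 - (1 - z * cot_delta k z) * (1 - z * cot_delta k z))%C
      (fun z => RtoC (k * k) * (z * z))%C).
    + apply (is_C_derive_minus (fun _ => 0%C)
        (fun z => (1 - z * cot_delta k z) * (1 - z * cot_delta k z))%C); [apply is_C_derive_const|].
      apply (is_C_derive_mult (fun z => 1 - z * cot_delta k z)%C (fun z => 1 - z * cot_delta k z)%C);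
        exact DE.
    + apply (is_C_derive_mult (fun _ => RtoC (k * k)) (fun z => z * z)%C); [apply is_C_derive_const|].
      apply (is_C_derive_mult (fun z => z) (fun z => z)); apply is_C_derive_id.
  - C_eq. unfold cot_g. ring.
Qed.

(** A solution of the linear equation g' = 2 delta g with g(0) = -1 cannot reach 0: along a ray
    |g|^2 decays at most at the exponential rate 4 K, with K bounding |delta|. *)
Lemma cot_g_neq_0 (k rho : R) : 0 <= rho < 1 -> k * k = 3 * (rho * rho) ->
  forall z, Cmod z < 1 -> cot_g k z <> 0%C.
Proof.
  intros Hrho Hk z Hz.
  assert (G0 : cot_g k 0%C = RtoC (-1)) by (unfold cot_g; apply injective_projections; simpl; ring).
  destruct (Ceq_dec z 0%C) as [->|Hz0].
  - rewrite G0. intros E. apply RtoC_inj in E. lra.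
  - pose proof (proj1 (Cmod_gt_0 z) Hz0) as Hm.
    set (r := Cmod z) in *. set (c := (z / RtoC r)%C).
    assert (Hr0 : RtoC r <> 0%C) by (intros E; apply RtoC_inj in E; lra).
    assert (Hc : Cmod c = 1).
    { unfold c. rewrite Cmod_div, Cmod_R, Rabs_pos_eq by (assumption || lra). fold r. field. lra. }
    assert (Hzc : z = (r * c)%C) by (unfold c; field; assumption).
    set (K := rho / (1 - rho)).
    assert (Hge := is_derive_ge_exp (fun s : R => Cnorm2 (cot_g k (s * c)%C))
      (fun s : R => 2 * Re (c * (2 * cot_delta k (s * c)%C)) * Cnorm2 (cot_g k (s * c)%C)) (- (4 * K)) r).
    cbv beta in Hge. rewrite <- Hzc in Hge.
    replace (RtoC 0 * c)%C with (RtoC 0) in Hge by ring.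
    intros E. rewrite E, G0 in Hge.
    assert (Cnorm2 (-1) <= Cnorm2 0 * exp (- - (4 * K) * r)).
    { apply Hge; [lra| |].
      - intros x Hx. apply is_derive_Cnorm2_ray.
        apply (is_C_derive_cot_g k rho Hrho Hk). rewrite Cmod_mult, Hc, Cmod_R, Rabs_pos_eq; lra.
      - intros x Hx.
        assert (Hxc : Cmod (x * c) < 1) by (rewrite Cmod_mult, Hc, Cmod_R, Rabs_pos_eq; lra).
        pose proof (cot_delta_bound k rho Hrho Hk _ Hxc) as HB. fold K in HB.
        apply Rmult_le_compat_r; [unfold Cnorm2; nra|].
        pose proof (Rabs_le_between (Re (c * (2 * cot_delta k (x * c)%C))) (2 * K)) as [HR _].
        assert (Rabs (Re (c * (2 * cot_delta k (x * c)%C))) <= 2 * K).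
        { eapply Rle_trans; [apply re_le_Cmod|]. rewrite !Cmod_mult, Hc, Cmod_R, Rabs_pos_eq; lra. }
        specialize (HR H). lra. }
    unfold Cnorm2, Re, Im in H. simpl in H. lra.
Qed.

(** This is k cot(kz), given through its Laurent series as [class_B] requires, so complex
    trigonometric functions do not enter. *)
Definition cot_f (k : R) (z : C) : C := (/ z - cot_delta k z)%C.

Lemma class_B_cot_f (k rho : R) : 0 <= rho < 1 -> k * k = 3 * (rho * rho) -> class_B (cot_f k).
Proof.
  intros Hrho Hk. exists (fun n => - RtoC (cot_coef k n))%C. intros z [Hz0 Hz].
  apply (proj2 (is_pseries_C_iff _ _ _)).
  pose proof (CPS_correct _ z (cot_radius k rho Hrho Hk) Hz) as S0.
  apply (is_C_series_scal (- (1))%C) in S0. fold (cot_delta k) in S0.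
  replace (cot_f k z - / z)%C with (- (1) * cot_delta k z)%C by (unfold cot_f; ring).
  eapply is_series_ext; [|exact S0]. intros n. cbv beta. C_eq. ring.
Qed.

Lemma Cderive_cot_f (k rho : R) : 0 <= rho < 1 -> k * k = 3 * (rho * rho) ->
  forall z, punctured_disk z -> Cderive (cot_f k) z = (cot_g k z / (z * z))%C.
Proof.
  intros Hrho Hk z [Hz0 Hz]. apply Cderive_unique.
  evar_last.
  - apply (is_C_derive_minus (fun z => / z)%C (cot_delta k)).
    + apply (is_C_derive_inv (fun z => z)); [apply is_C_derive_id|assumption].
    + apply (is_C_derive_CPS _ z (cot_radius k rho Hrho Hk) Hz).
  - fold (cot_delta1 k). C_eq.
    pose proof (cot_delta_riccati k rho Hrho Hk z Hz) as E.
    replace (cot_delta1 k z)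
      with ((RtoC (k * k) * z + z * (cot_delta k z * cot_delta k z) - 2 * cot_delta k z) / z)%C
      by (rewrite <- E; field; assumption).
    unfold cot_g. field. assumption.
Qed.

(** From f''/f' = - 2 f one gets S_f = - 2 f' - 2 f^2, which the Riccati equation makes constant. *)
Lemma schwarzian_cot_f (k rho : R) : 0 <= rho < 1 -> k * k = 3 * (rho * rho) ->
  forall z, punctured_disk z ->
  pre_schwarzian (cot_f k) z = (2 * cot_delta k z - 2 / z)%C /\
  schwarzian (cot_f k) z = RtoC (2 * (k * k)).
Proof.
  intros Hrho Hk z Hz.
  destruct (schwarzian_of_derive (cot_f k) (cot_g k) (fun z => 2 * cot_delta k z * cot_g k z)%C
    (fun z => (2 * cot_delta1 k z) * cot_g k z
       + 2 * cot_delta k z * (2 * cot_delta k z * cot_g k z))%C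
    (cot_g_neq_0 k rho Hrho Hk) (is_C_derive_cot_g k rho Hrho Hk)) with (z := z) as [E1 E2].
  - intros w Hw.
    apply (is_C_derive_mult (fun z => 2 * cot_delta k z)%C (cot_g k)).
    + evar_last.
      * apply (is_C_derive_mult (fun _ => 2%C) (cot_delta k)); [apply is_C_derive_const|].
        apply (is_C_derive_CPS _ w (cot_radius k rho Hrho Hk) Hw).
      * fold (cot_delta1 k). C_eq. ring.
    + now apply (is_C_derive_cot_g k rho Hrho Hk).
  - exact (Cderive_cot_f k rho Hrho Hk).
  - exact Hz.
  - rewrite E1, E2. destruct Hz as [Hz0 Hz].
    pose proof (cot_g_neq_0 k rho Hrho Hk z Hz) as Hg.
    pose proof (cot_delta_riccati k rho Hrho Hk z Hz) as E.
    split; [field; now split|].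
    replace (cot_delta1 k z)
      with ((RtoC (k * k) * z + z * (cot_delta k z * cot_delta k z) - 2 * cot_delta k z) / z)%C
      by (rewrite <- E; field; assumption).
    assert (H2 : RtoC 2 <> 0%C) by (intros E3; apply RtoC_inj in E3; lra).
    rewrite (RtoC_mult 2 (k * k)). field. now split.
Qed.

(* On the real axis [cot_f k] is [k cot(kx)]: [tau = (1 - x delta) sin(kx) - k x cos(kx)] solves
   the linear equation [tau' = delta tau] with [tau(0) = 0]. *)
Lemma cot_delta_real (k rho : R) : 0 <= rho < 1 -> k * k = 3 * (rho * rho) ->
  forall r, 0 <= r < 1 ->
  (1 - r * Re (cot_delta k r)) * sin (k * r) = k * r * cos (k * r).
Proof.
  intros Hrho Hk r Hr.
  set (E := fun z => (1 - z * cot_delta k z)%C).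
  (* Real and imaginary parts of [tau]. Carrying both avoids a separate proof that delta is real on
     the axis. *)
  set (t1 := fun x : R => Re (E (x * 1)%C) * sin (k * x) - k * x * cos (k * x)).
  set (t2 := fun x : R => Im (E (x * 1)%C) * sin (k * x)).
  set (de := fun x : R => cot_delta k (x * 1)%C).
  assert (Hm : forall x, 0 <= x < 1 -> Cmod (x * 1) < 1).
  { intros x Hx. rewrite Cmult_1_r, Cmod_R, Rabs_pos_eq; lra. }
  assert (ERe : forall x : R, Re (E (x * 1)%C) = 1 - x * Re (de x)).
  { intros x. unfold E, de. set (w := cot_delta k (x * 1)%C). unfold Re; simpl. ring. }
  assert (EIm : forall x : R, Im (E (x * 1)%C) = - x * Im (de x)).
  { intros x. unfold E, de. set (w := cot_delta k (x * 1)%C). unfold Im; simpl. ring. }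
  assert (D1 : forall x, 0 <= x < 1 -> is_derive t1 x (Re (de x) * t1 x - Im (de x) * t2 x)).
  { intros x Hx. pose proof (is_C_derive_cot_E k rho Hrho Hk _ (Hm x Hx)) as DE.
    apply is_derive_Re_ray in DE. fold E in DE. unfold t1, t2.
    evar_last.
    - apply (is_derive_minus (V := R_NormedModule)).
      + apply (is_derive_mult (K := R_AbsRing)); [exact DE| |exact Rmult_comm].
        auto_derive; [exact I|reflexivity].
      + auto_derive; [exact I|reflexivity].
    - change (cot_delta k (x * 1)%C) with (de x). change (1 - x * 1 * de x)%C with (E (x * 1)%C).
      replace (Re (1 * (de x * E (x * 1)%C - RtoC (k * k) * (x * 1))))
        with (Re (de x) * Re (E (x * 1)%C) - Im (de x) * Im (E (x * 1)%C) - k * k * x).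
      2:{ set (w := E (x * 1)%C). set (v := de x). unfold Re, Im; simpl. ring. }
      rewrite !ERe, !EIm. unfold minus, plus, opp, mult; simpl. ring. }
  assert (D2 : forall x, 0 <= x < 1 -> is_derive t2 x (Re (de x) * t2 x + Im (de x) * t1 x)).
  { intros x Hx. pose proof (is_C_derive_cot_E k rho Hrho Hk _ (Hm x Hx)) as DE.
    apply is_derive_Im_ray in DE. fold E in DE. unfold t1, t2.
    evar_last.
    - apply (is_derive_mult (K := R_AbsRing)); [exact DE| |exact Rmult_comm].
      auto_derive; [exact I|reflexivity].
    - change (cot_delta k (x * 1)%C) with (de x). change (1 - x * 1 * de x)%C with (E (x * 1)%C).
      replace (Im (1 * (de x * E (x * 1)%C - RtoC (k * k) * (x * 1))))
        with (Re (de x) * Im (E (x * 1)%C) + Im (de x) * Re (E (x * 1)%C)).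
      2:{ set (w := E (x * 1)%C). set (v := de x). unfold Re, Im; simpl. ring. }
      rewrite !ERe, !EIm. unfold plus, mult; simpl. ring. }
  set (K := rho / (1 - rho)).
  (* The square of |tau| grows at rate at most 2 K; the minus sign turns the lower bound of
     [is_derive_ge_exp] into an upper bound by its value 0 at the origin. *)
  assert (Hge : - (t1 0 * t1 0 + t2 0 * t2 0) <= - (t1 r * t1 r + t2 r * t2 r) * exp (- (2 * K) * r)).
  { apply (is_derive_ge_exp (fun x => - (t1 x * t1 x + t2 x * t2 x))
      (fun x => - (2 * Re (de x) * (t1 x * t1 x + t2 x * t2 x)))); [lra| |].
    - intros x Hx. specialize (D1 x ltac:(lra)). specialize (D2 x ltac:(lra)).
      set (a := Re (de x)) in *. set (b := Im (de x)) in *. clearbody a b.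
      evar_last.
      + apply (is_derive_opp (V := R_NormedModule)). apply (is_derive_plus (V := R_NormedModule)).
        * apply (is_derive_mult (K := R_AbsRing)); [exact D1|exact D1|exact Rmult_comm].
        * apply (is_derive_mult (K := R_AbsRing)); [exact D2|exact D2|exact Rmult_comm].
      + unfold plus, mult, opp; simpl. ring.
    - intros x Hx. pose proof (cot_delta_bound k rho Hrho Hk _ (Hm x ltac:(lra))) as HB.
      fold K in HB. fold (de x) in HB. pose proof (Re_le_Cmod (de x)) as HR.
      set (s := t1 x * t1 x + t2 x * t2 x). assert (0 <= s) by (unfold s; nra).
      assert (Re (de x) * s <= K * s) by (apply Rmult_le_compat_r; lra). lra. }
  assert (Z1 : t1 0 = 0) by (unfold t1; rewrite !Rmult_0_r, sin_0; ring).
  assert (Z2 : t2 0 = 0) by (unfold t2; rewrite !Rmult_0_r, sin_0; ring).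
  rewrite Z1, Z2 in Hge.
  assert (Ht : t1 r = 0).
  { pose proof (exp_pos (- (2 * K) * r)).
    set (s := t1 r * t1 r + t2 r * t2 r) in *.
    assert (s <= 0) by (apply Rnot_lt_le; intros Hs; nra). unfold s in *. nra. }
  unfold t1 in Ht. rewrite ERe in Ht. unfold de in Ht. rewrite Cmult_1_r in Ht. lra.
Qed.

(** Intermediate values for beta sin k - k cos k. This vanishes at k = 0, so the interval starts at
    [k0] with cos k0 = (1 + beta)/2 > beta, where sin k0 < k0 makes it nonpositive; at PI/2 its
    value is beta. *)
Lemma exists_cot_parameter (beta : R) : 0 <= beta < 1 ->
  exists k, 0 < k <= PI / 2 /\ k * cos k = beta * sin k.
Proof.
  intros Hb. set (b := (1 + beta) / 2). set (k0 := acos b).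
  assert (Hb' : -1 <= b <= 1) by (unfold b; lra).
  assert (Hcos : cos k0 = b) by (apply cos_acos; assumption).
  pose proof (acos_bound b) as [A1 A2]. fold k0 in A1, A2.
  pose proof PI_RGT_0 as HPI.
  assert (Hk0 : 0 < k0).
  { destruct (Req_dec k0 0) as [E|E]; [|lra]. rewrite E, cos_0 in Hcos. unfold b in Hcos. lra. }
  assert (Hk2 : k0 < PI / 2).
  { apply Rnot_le_lt. intros H. pose proof (cos_le_0 k0 H ltac:(lra)). unfold b in Hcos. lra. }
  destruct (IVT_gen (fun k => beta * sin k - k * cos k) k0 (PI / 2) 0) as [k [Hk1 Hk]].
  - intros x. apply derivable_continuous_pt, ex_derive_Reals_0. auto_derive. exact I.
  - rewrite sin_PI2, cos_PI2.
    pose proof (sin_lt_x k0 Hk0) as Hs.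
    assert (beta * sin k0 - k0 * cos k0 <= 0).
    { rewrite Hcos. assert (beta * sin k0 <= beta * k0) by (apply Rmult_le_compat_l; lra).
      assert (beta * k0 <= k0 * b) by (unfold b; nra). lra. }
    rewrite Rmin_left, Rmax_right by lra. lra.
  - rewrite Rmin_left, Rmax_right in Hk1 by lra. exists k. split; [lra|]. cbv beta in Hk. lra.
Qed.

(** Ensures k^2 < 3 for k <= PI/2, that is rho < 1. Five terms of Leibniz's series already give PI <
    3.4. *)
Lemma PI_sqr_lt_12 : PI * PI < 12.
Proof.
  pose proof (PI_ineq 2) as [_ H]. unfold tg_alt, PI_tg in H. simpl in H.
  pose proof PI_RGT_0. assert (PI < 3.4) by lra. nra.
Qed.

Lemma class_P_cot (beta k : R) : 0 < k <= PI / 2 -> k * cos k = beta * sin k ->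
  class_P beta (fun _ => k * k).
Proof.
  intros Hk Hb. pose proof PI_RGT_0 as HPI.
  split; [|split].
  - intros x Hx. apply filterlim_const.
  - intros r Hr. nra.
  - exists (fun x => sin (k * x) / k), (fun x => cos (k * x)).
    assert (L0 : forall (F : R -> R) (Q : R -> Prop) x l, ex_derive F x -> F x = l ->
      filterlim F (within Q (locally x)) (locally l)).
    { intros F Q x l HF <- P HP. destruct (ex_derive_continuous (V := R_NormedModule) F x HF P HP) as [e He].
      exists e. intros t Ht _. now apply He. }
    (* The endpoint 1 is included so that y'/y is continuous there and its limit is the value k cot
       k = beta. *)
    assert (Ps : forall x, 0 < x <= 1 -> 0 < sin (k * x)).
    { intros x Hx. apply sin_gt_0; nra. }
    repeat apply conj.
    + rewrite Rmult_0_r, sin_0. field. lra.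
    + now rewrite Rmult_0_r, cos_0.
    + apply L0; [auto_derive; exact I|]. rewrite Rmult_0_r, sin_0. field. lra.
    + apply L0; [auto_derive; exact I|]. now rewrite Rmult_0_r, cos_0.
    + intros x Hx. auto_derive; [exact I|]. field. lra.
    + intros x Hx. auto_derive; [exact I|]. field. lra.
    + intros x Hx. apply Rdiv_lt_0_compat; [apply Ps|]; lra.
    + pose proof (Ps 1 ltac:(lra)) as P1.
      exists (Finite beta). split; [|apply Rbar_le_refl].
      apply L0.
      * auto_derive. repeat split. apply Rgt_not_eq. apply Rdiv_lt_0_compat; lra.
      * rewrite Rmult_1_r in *. replace beta with (k * cos k / sin k) by (rewrite Hb; field; lra).
        field. lra.
Qed.

(** On the positive axis 1 + r f''/f' = 1 - 2 r k cot(kr), so convexity of order alpha would force r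
    k cot(kr) >= (1 + alpha)/2. As r -> 1 the left side tends to beta, which is smaller. Multiplying
    by sin(kr) gives [Psi] and removes the quotient. *)
Lemma not_class_BC_cot_f (alpha beta k rho : R) :
  0 <= rho < 1 -> k * k = 3 * (rho * rho) -> 0 < k <= PI / 2 -> k * cos k = beta * sin k ->
  beta < (1 + alpha) / 2 -> ~ class_BC alpha (cot_f k).
Proof.
  intros Hrho Hkr Hk Hb Hlt [_ [_ HBC]]. pose proof PI_RGT_0 as HPI.
  set (gamma := (1 + alpha) / 2) in *.
  set (Psi := fun x => k * x * cos (k * x) - gamma * sin (k * x)).
  assert (HPsi : forall r, 0 < r < 1 -> 0 <= Psi r).
  { intros r Hr.
    assert (Hr0 : RtoC r <> 0%C) by (intros E; apply RtoC_inj in E; lra).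
    assert (Hp : punctured_disk r) by (split; [assumption|rewrite Cmod_R, Rabs_pos_eq; lra]).
    specialize (HBC r Hp).
    pose proof (proj1 (schwarzian_cot_f k rho Hrho Hkr r Hp)) as E. unfold pre_schwarzian in E.
    rewrite E in HBC.
    replace (1 + r * (2 * cot_delta k r - 2 / r))%C with (RtoC (2 * r) * cot_delta k r - 1)%C in HBC
      by (rewrite RtoC_mult; field; assumption).
    replace (Re (RtoC (2 * r) * cot_delta k r - 1)) with (2 * r * Re (cot_delta k r) - 1) in HBC.
    2:{ set (w := cot_delta k r). unfold Re; simpl. ring. }
    pose proof (cot_delta_real k rho Hrho Hkr r ltac:(lra)) as T.
    unfold Psi. rewrite <- T.
    assert (0 < sin (k * r)) by (apply sin_gt_0; nra).
    replace ((1 - r * Re (cot_delta k r)) * sin (k * r) - gamma * sin (k * r))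
      with ((1 - r * Re (cot_delta k r) - gamma) * sin (k * r)) by ring.
    apply Rmult_le_pos; [unfold gamma; lra|lra]. }
  assert (Hs : 0 < sin k) by (apply sin_gt_0; lra).
  assert (H1 : Psi 1 < 0).
  { unfold Psi. rewrite !Rmult_1_r, Hb. nra. }
  assert (Hc : continuous Psi 1).
  { apply (ex_derive_continuous (V := R_NormedModule)). unfold Psi. auto_derive. exact I. }
  assert (Hpos : 0 < - Psi 1) by lra.
  pose proof (proj1 (filterlim_locally _ _) Hc (mkposreal _ Hpos)) as [e He].
  set (s := Rmin (e / 2) (1 / 2)). pose proof (cond_pos e) as Hepos.
  assert (Hs0 : 0 < s) by (apply Rmin_pos; lra).
  pose proof (Rmin_l (e / 2) (1 / 2)) as S1. pose proof (Rmin_r (e / 2) (1 / 2)) as S2.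
  fold s in S1, S2.
  assert (Hball : Rabs (Psi (1 - s) - Psi 1) < - Psi 1).
  { apply He. change (Rabs (1 - s - 1) < e). rewrite Rabs_left; lra. }
  apply Rabs_def2 in Hball. specialize (HPsi (1 - s) ltac:(lra)). lra.
Qed.

Theorem theorem2p7 (alpha : R) (Halpha : (0 <= alpha < 1)%R) :
  (forall (q : R -> R) (f : C -> C),
      class_P ((1 + alpha) / 2) q ->
      class_B f -> locally_univalent f ->
      (forall z, punctured_disk z -> (Cmod (schwarzian f z) <= 2 * q (Cmod z))%R) ->
      class_BC alpha f)
  /\
  (forall beta : R, (0 <= beta < (1 + alpha) / 2)%R ->
     exists (q : R -> R) (f : C -> C),
       class_P beta q /\ class_B f /\ locally_univalent f /\
       (forall z, punctured_disk z -> (Cmod (schwarzian f z) <= 2 * q (Cmod z))%R) /\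
       ~ class_BC alpha f).
Proof.
  split.
  - intros q f. now apply schwarzian_criterion.
  - intros beta Hbeta.
    destruct (exists_cot_parameter beta ltac:(lra)) as [k [Hk Hkb]].
    (* Chosen so that rho^2 = k^2/3 is the first nonzero coefficient of delta. *)
    set (rho := k / sqrt 3).
    assert (Hs3 : 0 < sqrt 3) by (apply sqrt_lt_R0; lra).
    assert (Hss : sqrt 3 * sqrt 3 = 3) by (apply sqrt_sqrt; lra).
    assert (Hkr : k * k = 3 * (rho * rho)).
    { unfold rho. rewrite <- Hss at 1. field. lra. }
    assert (Hrho : 0 <= rho < 1).
    { pose proof PI_sqr_lt_12. pose proof PI_RGT_0.
      assert (0 <= rho) by (apply Rlt_le, Rdiv_lt_0_compat; lra).
      split; [assumption|]. apply Rnot_le_lt. intros Hge. nra. }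
    exists (fun _ => k * k), (cot_f k).
    split; [|split; [|split; [|split]]].
    + now apply class_P_cot.
    + exact (class_B_cot_f k rho Hrho Hkr).
    + intros z Hz. rewrite (Cderive_cot_f k rho Hrho Hkr z Hz). destruct Hz as [Hz0 Hz].
      intros E. apply (cot_g_neq_0 k rho Hrho Hkr z Hz).
      replace (cot_g k z) with (cot_g k z / (z * z) * (z * z))%C by (field; assumption).
      rewrite E. ring.
    + intros z Hz. rewrite (proj2 (schwarzian_cot_f k rho Hrho Hkr z Hz)).
      rewrite Cmod_R, Rabs_pos_eq; nra.
    + now apply (not_class_BC_cot_f alpha beta k rho).
Qed.
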